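(* Let $G$ be a complex Lie group with Lie algebra $\mathfrak{g}$, let $\Psi:G\to\mathrm{GL}(\mathbb{C}^d)$ be a finite dimensional representation, and let $\rho:\mathfrak{g}\to\mathfrak{gl}(\mathbb{C}^d)=\mathbb{C}^{d\times d}$ be its tangent representation. If $\rho$ is irreducible, then for every $m\ge 2$ the center of the concomitant algebra $\mathcal{C}_G(\mathfrak{g}^{\oplus m},\mathbb{C}^{d\times d})$ equals $RI_d=\{fI_d\mid f\in R\}$, where $R=\mathbb{C}[\mathfrak{g}^{\oplus m}]^G$ and $I_d$ is the $d\times d$ identity matrix.
   Context: The group $G$ acts on $\mathfrak{g}$ via the adjoint representation $\mathrm{Ad}$, on $\mathfrak{g}^{\oplus m}$ (direct sum of $m$ copies) via $\mathrm{Ad}^{\oplus m}$, and on $\mathbb{C}^{d\times d}$ via $\widetilde\Psi(g)(M)=\Psi(g)M\Psi(g)^{-1}$. The tangent representation $\rho$ is the differential of $\Psi$ at the identity element of $G$. $\mathcal{C}_G(\mathfrak{g}^{\oplus m},\mathbb{C}^{d\times d})$ denotes the set of $G$-equivariant polynomial maps $\mathfrak{g}^{\oplus m}\to\mathbb{C}^{d\times d}$ (maps all of whose coordinate functions are polynomial functions on $\mathfrak{g}^{\oplus m}$); it is an associative $\mathbb{C}$-algebra under pointwise addition and multiplication. $R=\mathbb{C}[\mathfrak{g}^{\oplus m}]^G$ is the algebra of $\mathrm{Ad}^{\oplus m}$-invariant polynomial functions on $\mathfrak{g}^{\oplus m}$; for $f\in R$, $fI_d$ denotes the map $X\mapsto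 f(X)I_d$. *)

(* Defs.v *)
From HB Require Import structures.
From mathcomp Require Import all_boot all_order all_algebra.
From mathcomp Require Import complex.
From mathcomp Require Import all_classical all_reals all_analysis.
From mathcomp Require mpoly.

Set Implicit Arguments.
Unset Strict Implicit.
Unset Printing Implicit Defensive.

Import Order.TTheory GRing.Theory Num.Theory.
Import numFieldNormedType.Exports.

Local Open Scope complex_scope.
Local Open Scope classical_set_scope.
Local Open Scope ring_scope.

(* K stands for the field of complex numbers R[i], R : realType; it is kept
   abstract because the norm and topology of the library attach to an abstract
   numClosedFieldType.  For K = R[i], [differentiable] and ['d] are complex
   (Frechet) differentiability and the complex differential. *)

Definition holomorphic_on (K : numClosedFieldType) (E F : normedModType K)
    (D : set E) (f : E -> F) : Prop :=
  open D /\ forall x, D x -> differentiable f x.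

(* A chart carries an explicit inverse; the values of [chart_map] outside
   [chart_dom], and of [chart_inv] outside [chart_im], are irrelevant. *)
Record chart (M E : Type) := Chart {
  chart_dom : set M ;
  chart_map :> M -> E ;
  chart_inv : E -> M }.

Definition chart_im (M E : Type) (c : chart M E) : set E := c @` chart_dom c.

Definition is_chart (M E : topologicalType) (c : chart M E) : Prop :=
  [/\ open (chart_dom c), open (chart_im c),
      {within chart_dom c, continuous c},
      {within chart_im c, continuous (chart_inv c)} &
      forall p, chart_dom c p -> chart_inv c (c p) = p].

Definition chart_prod (M N E F : Type) (a : chart M E) (b : chart N F) :
    chart (M * N) (E * F) :=
  Chart (chart_dom a `*` chart_dom b)
        (fun p => (a p.1, b p.2))
        (fun x => (chart_inv a x.1, chart_inv b x.2)).

Definition chart_id (E : Type) : chart E E := Chart setT id id.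

Definition atlas_prod (M N E F : Type) (A : set (chart M E))
    (B : set (chart N F)) : set (chart (M * N) (E * F)) :=
  [set c | exists a b, [/\ A a, B b & c = chart_prod a b]].

Definition holomorphic_map (K : numClosedFieldType) (M N : topologicalType)
    (E F : normedModType K) (A : set (chart M E)) (B : set (chart N F))
    (f : M -> N) : Prop :=
  continuous f /\
  forall a b, A a -> B b ->
    holomorphic_on
      (chart_im a `&` [set x | chart_dom b (f (chart_inv a x))])
      (fun x => b (f (chart_inv a x))).

HB.mixin Record isComplexManifold (K : numClosedFieldType) (n : nat) M
    of Topological M := {
  atlas : set (chart M 'rV[K]_n) ;
  atlas_chart : forall c, atlas c -> is_chart c ;
  atlas_cover : forall p : M, exists2 c, atlas c & chart_dom c p ;
  atlas_compatible : holomorphic_map atlas atlas (@id M) ;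
  manifold_hausdorff : hausdorff_space M ;
  manifold_second_countable : @second_countable M }.

#[short(type="complexManifoldType")]
HB.structure Definition ComplexManifold (K : numClosedFieldType) (n : nat) :=
  { M of Topological M & isComplexManifold K n M }.

HB.mixin Record isComplexLieGroup (K : numClosedFieldType) (n : nat) G
    of Group G & ComplexManifold K n G := {
  mulg_holomorphic :
    holomorphic_map (atlas_prod (@atlas K n G) (@atlas K n G)) (@atlas K n G)
      (fun p : G * G => (p.1 * p.2)%g) ;
  invg_holomorphic :
    holomorphic_map (@atlas K n G) (@atlas K n G) (fun g : G => g^-1%g) }.

#[short(type="complexLieGroupType")]
HB.structure Definition ComplexLieGroup (K : numClosedFieldType) (n : nat) :=
  { G of Group G & ComplexManifold K n G & isComplexLieGroup K n G }.

Record is_representation (K : numClosedFieldType) (n d : nat)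
    (G : complexLieGroupType K n) (Psi : G -> 'M[K]_d) : Prop := {
  repr_unit : forall g, Psi g \in unitmx ;
  repr_mul : forall g h, Psi (g * h)%g = Psi g *m Psi h ;
  repr_holomorphic :
    holomorphic_map (@atlas K n G) [set chart_id 'M[K]_d] Psi }.

Definition chart_at_1 (K : numClosedFieldType) (n : nat)
    (G : complexLieGroupType K n) (c : chart G 'rV[K]_n) : Prop :=
  @atlas K n G c /\ chart_dom c 1%g.

(* The Lie algebra of G is its tangent space at 1, identified with
   'rV[K]_n through a chart c around 1; all the notions below are
   expressed in these coordinates.  Its bracket is not needed: the subspaces
   invariant under rho do not depend on it. *)

Definition Ad (K : numClosedFieldType) (n : nat) (G : complexLieGroupType K n)
    (c : chart G 'rV[K]_n) (g : G) : 'rV[K]_n -> 'rV[K]_n :=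
  'd (fun x => c (g * chart_inv c x * g^-1)%g) (c 1%g).

Definition tangent_repr (K : numClosedFieldType) (n d : nat)
    (G : complexLieGroupType K n) (c : chart G 'rV[K]_n)
    (Psi : G -> 'M[K]_d) : 'rV[K]_n -> 'M[K]_d :=
  'd (fun x => Psi (chart_inv c x)) (c 1%g).

Definition irreducible_rep (K : numClosedFieldType) (n d : nat)
    (rho : 'rV[K]_n -> 'M[K]_d) : Prop :=
  (0 < d)%N /\
  forall W : {vspace 'cV[K]_d},
    (forall X v, v \in W -> rho X *m v \in W) -> W = 0%VS \/ W = fullv.

(* An element (X_1, ..., X_m) of the direct sum of m copies of the Lie
   algebra is the m x n matrix whose i-th row is X_i. *)

Definition Ad_sum (K : numClosedFieldType) (n : nat)
    (G : complexLieGroupType K n) (c : chart G 'rV[K]_n)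
    (m : nat) (g : G) (X : 'M[K]_(m, n)) :
    'M[K]_(m, n) :=
  \matrix_(i < m) Ad c g (row i X).

Definition polynomial_function (K : comNzRingType) (m n : nat)
    (f : 'M[K]_(m, n) -> K) : Prop :=
  exists p : mpoly.mpoly (m * n) K,
    forall X, f X = mpoly.meval (fun k => mxvec X 0 k) p.

Definition invariant_polynomials (K : numClosedFieldType) (n : nat)
    (G : complexLieGroupType K n) (c : chart G 'rV[K]_n) (m : nat) :
    set ('M[K]_(m, n) -> K) :=
  [set f | polynomial_function f /\ forall g X, f (Ad_sum c g X) = f X].
Arguments invariant_polynomials {K n G} c m _.

Definition concomitants (K : numClosedFieldType) (n d : nat)
    (G : complexLieGroupType K n) (c : chart G 'rV[K]_n)
    (Psi : G -> 'M[K]_d) (m : nat) :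
    set ('M[K]_(m, n) -> 'M[K]_d) :=
  [set F : 'M[K]_(m, n) -> 'M[K]_d |
           (forall i j, polynomial_function (fun X => F X i j)) /\
           forall g X, F (Ad_sum c g X) = Psi g *m F X *m invmx (Psi g)].
Arguments concomitants {K n d G} c Psi m _.

Definition pointwise_center (K : pzRingType) (T : Type) (d : nat)
    (A : set (T -> 'M[K]_d)) : set (T -> 'M[K]_d) :=
  [set F | A F /\ forall H, A H -> forall X, F X *m H X = H X *m F X].

(* Main.v *)
Require Import Defs.
From HB Require Import structures.
From mathcomp Require Import all_boot all_order all_algebra.
From mathcomp Require Import complex.
From mathcomp Require Import all_classical all_reals all_analysis.
From mathcomp Require Import ring.
From mathcomp Require mpoly.

(** Let L be the image of the tangent representation rho, a linear subspace of
    the d x d matrices.  Differentiating Psi (g h g^-1) = Psi g Psi h Psi g^-1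
    gives rho (Ad g X) = Psi g rho(X) Psi g^-1 ([tangent_repr_Ad]), so each map
    X |-> rho(X_i) is a concomitant, and differentiating once more shows that L
    is closed under the matrix bracket ([tangent_repr_bracket]).

    The heart of the proof is [irreducible_two_element_commutant]: an
    irreducible bracket-closed space L of matrices contains A and B such that
    only scalar matrices commute with both.  A central concomitant F commutes
    with X |-> rho(X_1) and X |-> rho(X_2), so F is scalar at the points where
    rho(X_1) = A and rho(X_2) = B.  Along any line through such a point F is a
    polynomial in the parameter t, and comparing coefficients of t shows that
    all its coefficients are scalar ([scalar_along_line]); hence F is scalar
    everywhere, F = f I, and f is an entry of F, so it is a polynomial, and it
    is invariant because F is equivariant.

    The two elements come from the structure theory of L, developed for the
    trace form tr(xy) of the given representation.
    - Elements of L orthogonal to the normalizer of L are nilpotent: for such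
      an x whose diagonalizable part is diag(l), the matrix diag(conj l)
      normalizes L, so tr(x diag(conj l)) = sum |l_i|^2 vanishes.
      They form an ideal, which is zero by Engel's theorem
      and irreducibility.  This makes the trace form nondegenerate on L
      ([trace_form_nondegenerate]).  After adding the scalar matrices, L also
      contains the diagonalizable parts of its elements.
    - Take A in L diagonalizable with as many distinct differences of
      eigenvalues as possible, and work in an eigenbasis of A.  Maximality makes
      the centralizer of A in L consist of diagonal matrices whose entry
      differences depend only on those of A ([centralizer_diag]).
    - Each eigenspace of ad A on L for a nonzero eigenvalue has dimension at
      most one: otherwise a raising operator could be iterated forever
      ([root_vector_orth]).
    - Let B be the sum of one generator for each of these eigenspaces.  A matrix
      commuting with A and B commutes with each generator and with the
      centralizer of A, hence with L, and is scalar by Schur's lemma. *)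

Set Implicit Arguments.
Unset Strict Implicit.
Unset Printing Implicit Defensive.

Import Order.TTheory GRing.Theory Num.Theory.
Import numFieldNormedType.Exports.
(* Only the algebraic structures on multivariate polynomials are needed. *)
Import (canonicals) mpoly.

Local Open Scope complex_scope.
Local Open Scope classical_set_scope.
Local Open Scope ring_scope.

(** * Linear subspaces and the bracket of matrices *)

(** Subspaces are given below by propositional conditions; a subspace of
    maximal dimension among those contained in P is all of P. *)
Lemma vspace_of_pred (K : fieldType) (V : vectType K) (P : V -> Prop) :
  P 0 -> (forall a u v, P u -> P v -> P (a *: u + v)) ->
  exists U : {vspace V}, forall v, v \in U <-> P v.
Proof.
move=> P0 PD.
pose sub (U : {vspace V}) := forall v, v \in U -> P v.
pose D k := `[< exists2 U : {vspace V}, sub U & \dim U = k >].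
have D0 : exists k, D k.
  exists 0%N; apply/asboolP; exists 0%VS; last by rewrite dimv0.
  by move=> v; rewrite memv0 => /eqP->.
have Dle k : D k -> (k <= dim V)%N.
  by move=> /asboolP[U _ <-]; rewrite -dimvf dimvS ?subvf.
case: (ex_maxnP D0 Dle) => k /asboolP[U Usub dimU] kmax.
exists U => v; split=> [/Usub//|Pv].
have sUv : sub (U + <[v]>)%VS.
  move=> _ /memv_addP[u Uu [_ /vlineP[a ->] ->]].
  by rewrite addrC; apply: PD => //; apply: Usub.
have le : (\dim (U + <[v]>) <= \dim U)%N.
  by rewrite dimU; apply: kmax; apply/asboolP; exists (U + <[v]>)%VS.
have /eqP -> : U == (U + <[v]>)%VS by rewrite eqEdim addvSl.
exact: (subvP (addvSr U <[v]>)) (memv_line v).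
Qed.

(** The commutator of two square matrices, with the order xy - yx. *)
Definition bracket (K : pzRingType) (d : nat) (x y : 'M[K]_d) : 'M[K]_d :=
  x *m y - y *m x.

Section Bracket.
Variables (K : comPzRingType) (d : nat).
Implicit Types (x y z : 'M[K]_d) (a : K).

Lemma bracketDr x : {morph bracket x : y z / y + z}.
Proof. by move=> y z; rewrite /bracket mulmxDr mulmxDl opprD addrACA. Qed.

Lemma bracketZr a x y : bracket x (a *: y) = a *: bracket x y.
Proof. by rewrite /bracket -scalemxAr -scalemxAl scalerBr. Qed.

Lemma bracketC x y : bracket x y = - bracket y x.
Proof. by rewrite /bracket opprB. Qed.

Lemma bracketDl y : {morph (fun x => bracket x y) : x z / x + z}.
Proof. by move=> x z; rewrite bracketC bracketDr opprD -!bracketC. Qed.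

Lemma bracketZl a x y : bracket (a *: x) y = a *: bracket x y.
Proof. by rewrite bracketC bracketZr -scalerN -bracketC. Qed.

Lemma bracketNl x y : bracket (- x) y = - bracket x y.
Proof. by rewrite -scaleN1r bracketZl scaleN1r. Qed.

Lemma bracketxx x : bracket x x = 0.
Proof. exact: subrr. Qed.

Lemma bracketr0 x : bracket x 0 = 0.
Proof. by rewrite /bracket mulmx0 mul0mx subrr. Qed.

Lemma bracket0r x : bracket 0 x = 0.
Proof. by rewrite bracketC bracketr0 oppr0. Qed.

Lemma bracket_scalarr x a : bracket x a%:M = 0.
Proof. by rewrite /bracket scalar_mxC subrr. Qed.

Lemma bracket_scalarl x a : bracket a%:M x = 0.
Proof. by rewrite bracketC bracket_scalarr oppr0. Qed.

Lemma addmxE x y i j : (x + y) i j = x i j + y i j.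
Proof. by rewrite mxE. Qed.

Lemma oppmxE x i j : (- x) i j = - x i j.
Proof. by rewrite mxE. Qed.

(** The Jacobi identity, read as: the map [bracket x] is a derivation. *)
Lemma jacobi x y z :
  bracket x (bracket y z) = bracket (bracket x y) z + bracket y (bracket x z).
Proof.
rewrite /bracket !(mulmxBr, mulmxBl) !mulmxA; apply/matrixP => i j.
by rewrite !(addmxE, oppmxE); ring.
Qed.

(** Invariance of the trace form tr(xy). *)
Lemma mxtrace_bracket x y z :
  \tr (bracket x y *m z) = \tr (x *m bracket y z).
Proof.
rewrite /bracket mulmxBl mulmxBr !linearB /= !mulmxA; congr (_ - _).
by rewrite -mulmxA mxtrace_mulC -mulmxA mulmxA.
Qed.

Lemma bracket_eq0 x y : bracket x y = 0 -> x *m y = y *m x.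
Proof. by move/eqP; rewrite subr_eq0 => /eqP. Qed.
End Bracket.

(** * Jordan-Chevalley decomposition *)

Section Jordan.
Variable K : closedFieldType.

(** Chinese remainder theorem for prescribed constants modulo the coprime
    powers (X - a)^N. *)
Lemma crt_constants (rs : seq K) (N : nat) : uniq rs ->
  exists q : {poly K}, forall a, a \in rs -> ('X - a%:P) ^+ N %| q - a%:P.
Proof.
elim: rs => [|a rs IH] /=; first by exists 0.
case/andP=> nin /IH[q' q'P].
pose M := \prod_(b <- rs) ('X - b%:P) ^+ N.
have cop : coprimep M (('X - a%:P) ^+ N).
  rewrite /M; elim: rs nin {IH q'P M} => [|b rs IH] nin.
    by rewrite big_nil coprime1p.
  move: nin; rewrite in_cons negb_or => /andP[ab nin].
  rewrite big_cons coprimepMl IH // andbT.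
  apply: coprimep_expl; apply: coprimep_expr.
  by rewrite coprimep_XsubC root_XsubC.
have /Bezout_eq1_coprimepP[[u v] /= uv] := cop.
exists (q' + (a%:P - q') * (u * M)) => b; rewrite in_cons => /predU1P[->|brs].
  have -> : q' + (a%:P - q') * (u * M) - a%:P
    = (q' - a%:P) * v * ('X - a%:P) ^+ N.
    have -> : u * M = 1 - v * ('X - a%:P) ^+ N by rewrite -uv addrK.
    ring.
  exact: dvdp_mull.
rewrite addrAC dvdp_add ?q'P //.
apply: dvdp_mull; apply: dvdp_mull.
by rewrite /M (big_rem b) //= dvdp_mulr.
Qed.

(** Decomposition of x as a diagonalizable plus a commuting nilpotent matrix,
    written in an eigenbasis of the diagonalizable part; the rows of P form
    that basis of the space of row vectors.  The last clause holds because the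
    diagonalizable part is q(x) for a polynomial q congruent to the constant a
    modulo a high power of X - a, for every eigenvalue a of x. *)
Lemma jordan_decomposition (d : nat) (x : 'M[K]_d) :
  exists (P : 'M[K]_d) (l : 'rV[K]_d) (N : 'M[K]_d) (k : nat),
  [/\ P \in unitmx, P *m x *m invmx P = diag_mx l + N,
      diag_mx l *m N = N *m diag_mx l, N ^+ k = 0 &
      forall y, x *m y = y *m x ->
        invmx P *m diag_mx l *m P *m y = y *m (invmx P *m diag_mx l *m P)].
Proof.
case: d x => [|d] x.
  by exists 1%:M, 0, 0, 1%N; split; rewrite ?unitmx1 // => *; apply/matrixP => -[].
have [rs rsP] := closed_field_poly_normal (char_poly x).
rewrite (monicP (char_poly_monic x)) scale1r in rsP.
pose us := undup rs.
have uus : uniq us by exact: undup_uniq.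
have [q qP] := crt_constants (size rs) uus.
pose p := \prod_(a <- us) ('X - a%:P).
(* The exponent [size rs] is enough for every root multiplicity. *)
have dvd_p : char_poly x %| p ^+ size rs.
  have : {subset rs <= us} by move=> a; rewrite mem_undup.
  rewrite rsP /p; elim: {1 2 3}rs => [|a s IH] sub; first by rewrite big_nil dvd1p.
  rewrite big_cons exprS dvdp_mul ?IH // => [|b bs]; last first.
    by apply: sub; rewrite in_cons bs orbT.
  by rewrite (big_rem a) ?sub ?mem_head //= dvdp_mulr.
have ch0 r : p ^+ size rs %| r -> horner_mx x r = 0.
  move=> /(dvdp_trans dvd_p)/dvdpP[r' ->].
  by rewrite rmorphM /= (Cayley_Hamilton x) mulr0.
pose s := horner_mx x q.
have : exists2 P, P \in unitmx & similar_diag P s.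
  apply/diagonalizableP; exists us => //; apply: mxminpoly_min.
  rewrite rmorph_prod /=.
  rewrite (eq_bigr (fun a => horner_mx x (q - a%:P))); last first.
    by move=> a _; rewrite !rmorphB /= horner_mx_X !horner_mx_C.
  rewrite -rmorph_prod /=; apply: ch0.
  rewrite /p -prodrXl; elim: us qP {uus p dvd_p} => [|a us IH] qP.
    by rewrite !big_nil.
  rewrite !big_cons dvdp_mul ?qP ?mem_head ?IH // => b bs.
  by apply: qP; rewrite in_cons bs orbT.
case=> P Pu /(similar_diagPp P s) sP.
(* X - q vanishes at every eigenvalue, so p divides it. *)
have nil : (x - s) ^+ size rs = 0.
  have -> : x - s = horner_mx x ('X - q) by rewrite rmorphB /= horner_mx_X.
  rewrite -rmorphXn /=; apply: ch0; apply: dvdp_exp2r.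
  apply: uniq_roots_dvdp; last by rewrite uniq_rootsE.
  apply/allP => a aus; rewrite /root !hornerE.
  have [r] := dvdpP _ _ (qP a aus).
  have -> : size rs = (size rs).-1.+1.
    by rewrite prednK // -has_predT; apply/hasP; exists a => //; rewrite -mem_undup.
  move=> /(congr1 (fun f => f.[a])).
  rewrite exprS mulrCA hornerM hornerXsubC subrr mul0r !hornerE.
  by move/eqP; rewrite subr_eq0 => /eqP ->; rewrite subrr.
have sx : s *m x = x *m s by by have := comm_horner_mx2 x q 'X; rewrite horner_mx_X.
exists P, (\row_i (P *m s *m invmx P) i i), (P *m (x - s) *m invmx P), (size rs).
have sD : diag_mx (\row_i (P *m s *m invmx P) i i) = P *m s *m invmx P.
  apply/matrixP => i j; rewrite [LHS]mxE.
  case: eqVneq => [->|ij]; first by rewrite mulr1n [LHS]mxE.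
  by have := sP i j ij; rewrite conjumx // => ->.
split=> //.
- by rewrite sD -mulmxDl -mulmxDr addrCA subrr addr0.
- rewrite sD !mulmxA !mulmxKV //; congr (_ *m _).
  by rewrite -!mulmxA mulmxBl mulmxBr sx.
- have conjX k : (P *m (x - s) *m invmx P) ^+ k = P *m (x - s) ^+ k *m invmx P.
    elim: k => [|k IH]; first by rewrite !expr0 mulmx1 mulmxV.
    by rewrite !exprS IH -!mulmxE !mulmxA mulmxKV.
  by rewrite conjX nil mulmx0 mul0mx.
- move=> y xy; rewrite sD !mulmxA mulVmx // mul1mx !mulmxKV //.
  exact: (comm_horner_mx q xy).
Qed.
End Jordan.

(** * Invariant subspaces and components of generalized eigenvectors *)

HB.instance Definition _ (K : comPzRingType) (d : nat) (x : 'M[K]_d) :=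
  GRing.isLinear.Build K 'M[K]_d 'M[K]_d *:%R (bracket x)
    (fun a y z => eq_trans (bracketDr x (a *: y) z)
       (congr1 (fun t => t + bracket x z) (bracketZr a x y))).

Section GeneralizedEigen.
Variables (K : fieldType) (V : vectType K) (T : {linear V -> V}).
Variables (L : {vspace V}).
Hypothesis TL : forall v, v \in L -> T v \in L.

Let shift a v := T v - a *: v.

Lemma shiftL a v : v \in L -> shift a v \in L.
Proof. by move=> Lv; rewrite rpredB ?TL ?rpredZ. Qed.

Lemma iter_shiftL k a v : v \in L -> iter k (shift a) v \in L.
Proof. by move=> Lv; elim: k => //= k; apply: shiftL. Qed.

Lemma shiftC a b v : shift a (shift b v) = shift b (shift a v).
Proof.
rewrite /shift !linearB !linearZ /= !scalerA [b * a]mulrC !addrA.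
by congr (_ + _); rewrite addrAC.
Qed.

Lemma iter_shiftC k a b v :
  iter k (shift a) (shift b v) = shift b (iter k (shift a) v).
Proof. by elim: k => //= k ->; rewrite shiftC. Qed.

Lemma iter_shiftCC k m a b v :
  iter k (shift a) (iter m (shift b) v) = iter m (shift b) (iter k (shift a) v).
Proof. by elim: m => //= m <-; rewrite iter_shiftC. Qed.

Lemma iter_shiftD k a : {morph iter k (shift a) : u v / u + v}.
Proof.
elim: k => [|k IH] u v //=; rewrite IH /shift linearD scalerDr opprD.
by rewrite addrACA.
Qed.

Lemma iter_shift0 k a : iter k (shift a) 0 = 0.
Proof. by elim: k => //= k ->; rewrite /shift linear0 scaler0 subrr. Qed.

(** T - a is nilpotent on v and T - b maps v into the invariant subspace L.
    As (a - b) v is the difference of (T - b) v and (T - a) v, induction on the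
    order of nilpotency gives v in L. *)
Lemma mem_of_shift k a b v : a != b -> iter k (shift a) v = 0 ->
  shift b v \in L -> v \in L.
Proof.
move=> ab; elim: k v => [|k IH] v /=; first by move->; rewrite mem0v.
move=> kv Lv; have aL : shift a v \in L.
  by apply: IH; rewrite ?iter_shiftC // shiftC shiftL.
have E : shift b v - shift a v = (a - b) *: v.
    by rewrite /shift opprB addrC addrA subrK scalerBl.
have : (a - b) *: v \in L by rewrite -E memvB.
by rewrite rpredZeq subr_eq0 (negPf ab).
Qed.

Lemma mem_of_iter_shift k m a b v : a != b -> iter k (shift a) v = 0 ->
  iter m (shift b) v \in L -> v \in L.
Proof.
move=> ab kv; elim: m => //= m IH Lv; apply: IH; apply: (mem_of_shift (k := k) ab _ Lv).
by rewrite iter_shiftCC kv iter_shift0.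
Qed.

(** If a sum of generalized eigenvectors for distinct eigenvalues lies in an
    invariant subspace, so does each term. *)
Lemma mem_generalized_component k (s : seq K) (y : K -> V) : uniq s ->
  (forall a, a \in s -> iter k (shift a) (y a) = 0) ->
  \sum_(a <- s) y a \in L -> forall a, a \in s -> y a \in L.
Proof.
elim: s y => //= b s IH y /andP[bs us] yk; rewrite big_cons => Ly.
have Ls a : a \in s -> y a \in L.
  move=> sa; have ab : a != b by apply: contraNneq bs => <-.
  have yka : iter k (shift a) (y a) = 0 by apply: yk; rewrite inE sa orbT.
  apply: (mem_of_iter_shift (m := k) ab yka).
  apply: (IH (fun a => iter k (shift b) (y a))) => // [c sc|].
    by rewrite iter_shiftCC yk ?iter_shift0 // inE sc orbT.
  rewrite -(big_morph _ (iter_shiftD k b) (iter_shift0 k b)).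
  have := iter_shiftL k b Ly; rewrite iter_shiftD yk ?mem_head //.
  by rewrite add0r.
move=> a; rewrite inE => /predU1P[->|/Ls//].
have Ls' : \sum_(a <- s) y a \in L.
  by rewrite big_seq_cond rpred_sum // => c /andP[/Ls].
by rewrite -(addrK (\sum_(a <- s) y a) (y b)) rpredB.
Qed.
End GeneralizedEigen.

Section SpectralNormalizer.
Variables (K : fieldType) (d : nat).
Implicit Types (x y N : 'M[K]_d) (l : 'rV[K]_d).

(** ad N is nilpotent when N is: (ad N)^n y is a sum of terms N^i f N^j with
    i + j = n. *)
Lemma iter_bracket_nilp N k y :
  N ^+ k = 0 -> iter (k + k) (bracket N) y = 0.
Proof.
move=> Nk.
have Nge j : (k <= j)%N -> N ^+ j = 0 by move=> kj; rewrite -(subnK kj) exprD Nk mulr0.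
suff H n : exists f : nat -> 'M[K]_d,
    iter n (bracket N) y = \sum_(j < n.+1) N ^+ (n - j) *m f j *m N ^+ j.
  have [f ->] := H (k + k)%N; apply: big1 => j _.
  have [kj|jk] := leqP k j; first by rewrite (Nge j) // mulmx0.
  by rewrite (Nge (k + k - j)%N) ?mul0mx // leq_subRL ?leq_add2r // ltnW // ltn_addl.
elim: n => [|n [f IH]].
  by exists (fun=> y); rewrite big_ord1 /= mul1mx mulmx1.
exists (fun j => (if (j <= n)%N then f j else 0) - (if j is j'.+1 then f j' else 0)).
rewrite iterS IH /bracket mulmx_sumr mulmx_suml.
under [RHS]eq_bigr do rewrite mulmxBr mulmxBl.
rewrite sumrB; congr (_ - _).
  rewrite [RHS]big_ord_recr /= ltnn mulmx0 mul0mx addr0; apply: eq_bigr => j _.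
  by rewrite -ltnS ltn_ord subSn -1?ltnS // exprS !mulmxA.
rewrite [RHS]big_ord_recl /= mulmx0 mul0mx add0r; apply: eq_bigr => j _.
by rewrite /= subSS exprSr !mulmxA.
Qed.

(** The component of y on the eigenspace of ad (diag l) for the eigenvalue a:
    the entries (i, j) of y with l_i - l_j = a. *)
Definition diff_part l (a : K) y : 'M[K]_d :=
  \matrix_(i, j) if l 0 i - l 0 j == a then y i j else 0.

Lemma bracket_diagE l y i j :
  bracket (diag_mx l) y i j = (l 0 i - l 0 j) * y i j.
Proof.
rewrite /bracket mul_diag_mx mul_mx_diag addmxE oppmxE !mxE.
by rewrite mulrBl [l 0 j * _]mulrC.
Qed.

Lemma bracket_diff_part l a y :
  bracket (diag_mx l) (diff_part l a y) = a *: diff_part l a y.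
Proof.
apply/matrixP => i j; rewrite bracket_diagE !mxE.
by case: eqP => [->//|]; rewrite !mulr0.
Qed.

(** The eigenvalues of ad (diag l), without repetition. *)
Definition diffs l : seq K :=
  undup [seq l 0 p.1 - l 0 p.2 | p <- enum {: 'I_d * 'I_d}].

Lemma mem_diffs l i j : l 0 i - l 0 j \in diffs l.
Proof.
by rewrite mem_undup; apply/mapP; exists (i, j); rewrite ?mem_enum.
Qed.

Lemma sum_diff_part l (c : K -> K) y :
  \sum_(a <- diffs l) c a *: diff_part l a y
    = \matrix_(i, j) (c (l 0 i - l 0 j) * y i j).
Proof.
apply/matrixP => i j; rewrite summxE mxE.
rewrite (bigD1_seq _ (mem_diffs l i j) (undup_uniq _)) /= !mxE eqxx.
rewrite big1 ?addr0 // => a; rewrite eq_sym !mxE => /negPf ->.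
by rewrite mulr0.
Qed.

(** A subspace stable under ad (diag l + N) contains the components of its
    elements for ad (diag l), because these are generalized eigenvectors of
    ad (diag l + N). *)
Lemma diff_part_mem l N k (L : {vspace 'M[K]_d}) :
  diag_mx l *m N = N *m diag_mx l -> N ^+ k = 0 ->
  (forall y, y \in L -> bracket (diag_mx l + N) y \in L) ->
  forall a y, y \in L -> diff_part l a y \in L.
Proof.
move=> lN Nk xL a y Ly.
have [al|nal] := boolP (a \in diffs l); last first.
  rewrite [diff_part l a y](_ : _ = 0) ?mem0v //; apply/matrixP => i j.
  by rewrite !mxE; case: eqP => // e; rewrite -e mem_diffs in nal.
pose T : {linear 'M[K]_d -> 'M[K]_d} := bracket (diag_mx l + N).
have DN : bracket (diag_mx l) N = 0 by rewrite /bracket lN subrr.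
have Nw b w : bracket (diag_mx l) w = b *: w ->
    iter (k + k) (fun v => T v - b *: v) w = iter (k + k) (bracket N) w.
  move=> lw; suff [] : iter (k + k) (fun v => T v - b *: v) w = iter (k + k) (bracket N) w /\
    bracket (diag_mx l) (iter (k + k) (bracket N) w) = b *: iter (k + k) (bracket N) w by [].
  elim: (k + k)%N => [//|n /= [-> IH]]; split.
    by rewrite /T bracketDl IH addrAC subrr add0r.
  by rewrite jacobi DN bracket0r add0r IH linearZ.
apply: (@mem_generalized_component _ _ T L xL (k + k) (diffs l)
  (fun a => diff_part l a y)) => // [|b _|].
- exact: undup_uniq.
- by rewrite Nw ?bracket_diff_part // iter_bracket_nilp.
- have := sum_diff_part l (fun=> 1) y.
  under eq_bigr do rewrite scale1r; move=> ->.
  rewrite [X in X \in L](_ : _ = y) //.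
  by apply/matrixP => i j; rewrite mxE mul1r.
Qed.

(** For additive phi, ad (diag (phi l)) acts on the component for the
    eigenvalue a by the scalar phi(a). *)
Lemma additive_diag_mem l N k (phi : K -> K) (L : {vspace 'M[K]_d}) :
  (forall a b, phi (a - b) = phi a - phi b) ->
  diag_mx l *m N = N *m diag_mx l -> N ^+ k = 0 ->
  (forall y, y \in L -> bracket (diag_mx l + N) y \in L) ->
  forall y, y \in L -> bracket (diag_mx (map_mx phi l)) y \in L.
Proof.
move=> phiB lN Nk xL y Ly.
rewrite [bracket _ y](_ : _ = \sum_(a <- diffs l) phi a *: diff_part l a y).
  by rewrite rpred_sum // => a _; rewrite rpredZ // (diff_part_mem lN Nk xL).
rewrite sum_diff_part; apply/matrixP => i j.
by rewrite bracket_diagE !mxE phiB.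
Qed.

(** Conjugation by an invertible P: the matrix of v |-> v x in the basis of row
    vectors formed by the rows of P. *)
Definition conj_by (P x : 'M[K]_d) := P *m x *m invmx P.

Lemma bracket_conj_by P x y : P \in unitmx ->
  bracket (conj_by P x) (conj_by P y) = conj_by P (bracket x y).
Proof.
move=> Pu; rewrite /bracket /conj_by mulmxBr mulmxBl !mulmxA.
by rewrite !mulmxKV.
Qed.

Lemma conj_byK P x : P \in unitmx -> conj_by (invmx P) (conj_by P x) = x.
Proof.
by move=> Pu; rewrite /conj_by invmxK !mulmxA mulVmx // mul1mx mulmxKV.
Qed.

Lemma conj_byVK P x : P \in unitmx -> conj_by P (conj_by (invmx P) x) = x.
Proof.
by move=> Pu; rewrite -{1}[P]invmxK conj_byK // unitmx_inv.
Qed.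

Lemma mxtrace_conj_by P x : P \in unitmx -> \tr (conj_by P x) = \tr x.
Proof. by move=> Pu; rewrite /conj_by mxtrace_mulC mulmxA mulVmx // mul1mx. Qed.

Lemma conj_byM P x y : P \in unitmx ->
  conj_by P x *m conj_by P y = conj_by P (x *m y).
Proof. by move=> Pu; rewrite /conj_by !mulmxA mulmxKV. Qed.

Lemma conj_byX P x k : P \in unitmx -> conj_by P x ^+ k = conj_by P (x ^+ k).
Proof.
move=> Pu; elim: k => [|k IH]; first by rewrite !expr0 /conj_by mulmx1 mulmxV.
by rewrite !exprS IH -!mulmxE conj_byM.
Qed.

Lemma conj_by_invM P Q y : P \in unitmx -> Q \in unitmx ->
  conj_by (invmx Q) (conj_by (invmx P) y) = conj_by (invmx (P *m Q)) y.
Proof.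
move=> Pu Qu; rewrite /conj_by !invmxK.
have -> : invmx (P *m Q) = invmx Q *m invmx P.
  have PQu : P *m Q \in unitmx by rewrite unitmx_mul Pu.
  apply: (can_inj (mulKmx PQu)).
  by rewrite mulmxV // !mulmxA mulmxK // mulmxV.
by rewrite !mulmxA.
Qed.

Lemma conj_vspace P (L : {vspace 'M[K]_d}) :
  exists L' : {vspace 'M[K]_d}, forall y, y \in L' <-> conj_by (invmx P) y \in L.
Proof.
apply: vspace_of_pred => [|a u v Lu Lv]; first by rewrite /conj_by mulmx0 mul0mx mem0v.
by rewrite /conj_by mulmxDr mulmxDl -scalemxAr -scalemxAl rpredD ?rpredZ.
Qed.

(** If x normalizes L, so does the diagonalizable matrix obtained from the
    diagonalizable part of x by applying an additive map phi to its eigenvalues.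
    It is used with phi the identity and with phi the complex conjugation. *)
Lemma jordan_additive_normalizes P x l N k (phi : K -> K) (L : {vspace 'M[K]_d}) :
  P \in unitmx -> conj_by P x = diag_mx l + N ->
  diag_mx l *m N = N *m diag_mx l -> N ^+ k = 0 ->
  (forall a b, phi (a - b) = phi a - phi b) ->
  (forall y, y \in L -> bracket x y \in L) ->
  forall y, y \in L ->
    bracket (conj_by (invmx P) (diag_mx (map_mx phi l))) y \in L.
Proof.
move=> Pu xE lN Nk phiB xL y Ly.
have Vu : invmx P \in unitmx by rewrite unitmx_inv.
have [L' L'P] := conj_vspace P L.
rewrite -{1}(conj_byK y Pu) bracket_conj_by //; apply/L'P.
apply: (additive_diag_mem phiB lN Nk) => [z /L'P Lz|].
  by apply/L'P; rewrite -bracket_conj_by // -xE conj_byK // xL.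
by apply/L'P; rewrite conj_byK.
Qed.
End SpectralNormalizer.

(** * Engel's theorem and Schur's lemma *)

(** L is a Lie subalgebra of the matrix algebra. *)
Definition bracket_closed (K : fieldType) (d : nat) (L : {vspace 'M[K]_d}) :=
  forall x y, x \in L -> y \in L -> bracket x y \in L.

(** L has no invariant subspace of column vectors other than the two trivial
    ones.  The case d = 0 is not excluded here. *)
Definition irreducible_mxs (K : fieldType) (d : nat) (L : {vspace 'M[K]_d}) :=
  forall W : {vspace 'cV[K]_d},
    (forall x v, x \in L -> v \in W -> x *m v \in W) -> W = 0%VS \/ W = fullv.

Lemma dim_add_line (K : fieldType) (V : vectType K) (U : {vspace V}) (v : V) :
  v \notin U -> \dim (U + <[v]>) = (\dim U).+1.
Proof.
move=> vU; rewrite dimv_disjoint_sum.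
  by rewrite dim_vline (_ : v != 0) ?addn1 //; apply: contraNneq vU => ->; rewrite mem0v.
apply/eqP; rewrite -subv0; apply/subvP => w /memv_capP[Uw /vlineP[a wE]].
rewrite memv0 wE; have [->|a0] := eqVneq a 0; first by rewrite scale0r.
by rewrite wE rpredZeq (negPf a0) (negPf vU) in Uw.
Qed.

(** Engel's theorem for a Lie algebra S of nilpotent matrices acting by
    nilpotent operators on a space V, relative to invariant subspaces U and W.
    The relative form and the general action let the induction on dim S use the
    lemma for the adjoint action of a smaller subalgebra P on S modulo P. *)
Lemma engel_relative (K : fieldType) (d : nat) (S : {vspace 'M[K]_d})
    (V : vectType K) (act : 'M[K]_d -> V -> V) (U W : {vspace V}) :
  bracket_closed S ->
  (forall x, x \in S -> exists m, x ^+ m = 0) ->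
  (forall a x y v, act (a *: x + y) v = a *: act x v + act y v) ->
  (forall x y v, x \in S -> y \in S ->
     act (bracket x y) v = act x (act y v) - act y (act x v)) ->
  (forall x v, x \in S -> exists m, iter m (act x) v = 0) ->
  (forall x v, x \in S -> v \in U -> act x v \in U) ->
  (forall x v, x \in S -> v \in W -> act x v \in W) ->
  ~~ (W <= U)%VS ->
  exists w, [/\ w \in W, w \notin U & forall x, x \in S -> act x w \in U].
Proof.
have [k] := ubnP (\dim S).
elim: k => // k IH in S V act U W *; rewrite ltnS => dimS Sb Snil actl actb actn SU SW WU.
have act0 v : act 0 v = 0.
  by have := actl (-1) 0 0 v; rewrite scaler0 addr0 scaleN1r addNr.
(* For a proper subalgebra P of S, some z in S outside P normalizes P. *)
have grow (P : {vspace 'M[K]_d}) : (P <= S)%VS -> bracket_closed P ->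
    (\dim P < \dim S)%N ->
    exists z, [/\ z \in S, z \notin P & forall x, x \in P -> bracket x z \in P].
  move=> PS Pb ltPS; have PS' := subvP PS.
  apply: (IH P _ (@bracket K d) P S) => //.
  - exact: leq_trans dimS.
  - by move=> x /PS'; apply: Snil.
  - by move=> a x y v; rewrite bracketDl bracketZl.
  - by move=> x y v _ _; rewrite jacobi addrK.
  - by move=> x v /PS'/Snil[m xm]; exists (m + m)%N; apply: iter_bracket_nilp.
  - by move=> x v /PS' Sx Sv; apply: Sb.
  - by apply: contraL ltPS => /dimvS; rewrite -leqNgt.
have [->|S0] := eqVneq S 0%VS.
  have [w Ww Uw] := subvPn WU; exists w; split=> // x; rewrite memv0 => /eqP ->.
  by rewrite act0 mem0v.
have dS : (0 < \dim S)%N by rewrite lt0n dimv_eq0.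
have [P [PS Pb dP]] : exists P : {vspace 'M[K]_d},
    [/\ (P <= S)%VS, bracket_closed P & \dim P = (\dim S).-1].
  have : ((\dim S).-1 < \dim S)%N by rewrite prednK.
  elim: (\dim S).-1 => [_|j IHj ltj].
    exists 0%VS; rewrite sub0v dimv0; split=> // x y.
    by rewrite !memv0 => /eqP -> _; rewrite bracket0r.
  have [P [PS Pb dP]] := IHj (ltnW ltj).
  have [|z [Sz Pz bz]] := grow P PS Pb; first by rewrite dP ltnW.
  exists (P + <[z]>)%VS; split; last by rewrite dim_add_line ?dP.
    by rewrite subv_add PS -memvE.
  move=> _ _ /memv_addP[p Pp [_ /vlineP[a ->] ->]] /memv_addP[q Pq [_ /vlineP[b ->] ->]].
  apply: (subvP (addvSl P <[z]>)).
  rewrite bracketDl !bracketDr !bracketZl !bracketZr bracketxx !scaler0 addr0.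
  apply: memvD; last by rewrite memvZ // bracketC memvN bz.
  by rewrite memvD ?Pb // memvZ // bz.
have ltPS : (\dim P < \dim S)%N by rewrite dP prednK.
have [z [Sz Pz bz]] := grow P PS Pb ltPS.
have PS' := subvP PS.
have SE : S = (P + <[z]>)%VS.
  apply/eqP; rewrite eq_sym eqEdim subv_add PS -memvE Sz dim_add_line //=.
  by rewrite dP prednK.
have [w0 [Ww0 Uw0 Pw0]] : exists w0,
    [/\ w0 \in W, w0 \notin U & forall x, x \in P -> act x w0 \in U].
  apply: IH => //.
  - exact: leq_trans dimS.
  - by move=> x /PS'; apply: Snil.
  - by move=> x y v /PS' Sx /PS' Sy; apply: actb.
  - by move=> x v /PS' Sx; apply: actn.
  - by move=> x v /PS' Sx; apply: SU.
  - by move=> x v /PS' Sx; apply: SW.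
(* The vectors of W mapped into U by P are stable under z, as [P, z] lies in P. *)
have zP m : iter m (act z) w0 \in W /\
    forall x, x \in P -> act x (iter m (act z) w0) \in U.
  elim: m => //= m [IW IU]; split=> [|x Px]; first exact: SW.
  have := actb x z (iter m (act z) w0) (PS' _ Px) Sz.
  move/eqP; rewrite eq_sym subr_eq => /eqP ->.
  by rewrite memvD ?IU ?bz // SU ?IU.
have exU : exists m, iter m (act z) w0 \in U.
  by have [m zm] := actn z w0 Sz; exists m; rewrite zm mem0v.
(* The last iterate outside U is the required vector. *)
case: (ex_minnP exU) => -[|m] Um mmin; first by rewrite /= (negPf Uw0) in Um.
exists (iter m (act z) w0); split.
- by have [] := zP m.
- by apply/negP => /mmin; rewrite ltnn.
- move=> x; rewrite SE => /memv_addP[p Pp [_ /vlineP[a ->] ->]].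
  rewrite addrC actl memvD ?memvZ //.
  by have [_] := zP m; apply.
Qed.

Lemma schur (K : closedFieldType) (d : nat) (L : {vspace 'M[K]_d}) (F : 'M[K]_d) :
  (0 < d)%N -> irreducible_mxs L ->
  (forall x, x \in L -> x *m F = F *m x) -> exists c, F = c%:M.
Proof.
move=> d0 irr FL.
have [c] : exists c, root (char_poly F^T) c.
  by apply/closed_rootP; rewrite size_char_poly eqSS -lt0n.
rewrite -eigenvalue_root_char => /eigenvalueP[v vF v0].
have [W WP] : exists W : {vspace 'cV[K]_d}, forall w, w \in W <-> F *m w = c *: w.
  apply: vspace_of_pred => [|a u w Fu Fw]; first by rewrite mulmx0 scaler0.
  by rewrite mulmxDr -scalemxAr Fu Fw scalerDr !scalerA mulrC.
exists c; have [x w Lx /WP Fw|W0|Wf] := irr W.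
- by apply/WP; rewrite mulmxA -FL // -mulmxA Fw scalemxAr.
- have /WP : F *m v^T = c *: v^T by rewrite -[F]trmxK -trmx_mul vF linearZ.
  by rewrite W0 memv0 trmx_eq0 (negPf v0).
- apply/matrixP => i j.
  have /WP : (delta_mx j 0 : 'cV[K]_d) \in W by rewrite Wf memvf.
  rewrite -colE => /matrixP/(_ i 0).
  by rewrite !mxE eqxx andbT mulr_natr => ->.
Qed.

(** * Nondegeneracy of the trace form *)

Section Nondegenerate.
Variable (K : numClosedFieldType).

Lemma mxtrace_nilp (d : nat) (N : 'M[K]_d) k : N ^+ k = 0 -> \tr N = 0.
Proof.
case: d N => [|d] N Nk; first by rewrite /mxtrace big_ord0.
have [rs] := closed_field_poly_normal (char_poly N).
rewrite (monicP (char_poly_monic N)) scale1r => rsP.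
have rs0 a : a \in rs -> a = 0.
  rewrite -root_prod_XsubC -rsP -eigenvalue_root_char => /eigenvalueP[v vN v0].
  have : v *m N ^+ k = a ^+ k *: v.
    elim: k {Nk} => [|k IH]; first by rewrite !expr0 mulmx1 scale1r.
    by rewrite exprSr -mulmxE mulmxA IH -scalemxAl vN scalerA -exprSr.
  rewrite Nk mulmx0 => /esym/eqP; rewrite scaler_eq0 (negPf v0) orbF expf_eq0.
  by case/andP => _ /eqP.
have chX : char_poly N = 'X^(size rs).
  rewrite rsP big_seq (eq_bigr (fun=> 'X)) -?big_seq; last first.
    by move=> a /rs0 ->; rewrite subr0.
  by rewrite big_const_seq count_predT iter_mulr_1.
have := @char_poly_trace K d.+1 N isT.
have := size_char_poly N; rewrite chX size_polyXn => -[->].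
by rewrite coefXn /= ltn_eqF // => /eqP; rewrite eq_sym oppr_eq0 => /eqP.
Qed.

Lemma diag_comm_map (d : nat) (l : 'rV[K]_d) (N : 'M[K]_d) (phi : K -> K) :
  diag_mx l *m N = N *m diag_mx l ->
  diag_mx (map_mx phi l) *m N = N *m diag_mx (map_mx phi l).
Proof.
move=> lN; apply/matrixP => i j; have /matrixP/(_ i j) := lN.
rewrite !mul_diag_mx !mul_mx_diag !mxE mulrC => /eqP.
rewrite -subr_eq0 -mulrBr mulf_eq0 => /orP[/eqP ->|]; first by rewrite mulr0 mul0r.
by rewrite subr_eq0 => /eqP ->; rewrite mulrC.
Qed.

Lemma sum_normC_eq0 (d : nat) (l : 'rV[K]_d) :
  \sum_i l 0 i * (l 0 i)^* = 0 -> l = 0.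
Proof.
move/eqP; rewrite psumr_eq0 => [/allP l0|i _]; last exact: mul_conjC_ge0.
apply/rowP => i; rewrite mxE; apply/eqP; rewrite -mul_conjC_eq0.
by apply: l0; rewrite mem_index_enum.
Qed.

(** With x = diag(l) + N in a suitable basis, diag(conj l) normalizes L, and
    tr(x diag(conj l)) is the sum of the |l_i|^2. *)
Lemma nilp_of_orth_normalizer (d : nat) (L : {vspace 'M[K]_d}) x :
  (forall y, y \in L -> bracket x y \in L) ->
  (forall u, (forall y, y \in L -> bracket u y \in L) -> \tr (x *m u) = 0) ->
  exists m, x ^+ m = 0.
Proof.
move=> xL xorth; have [P [l [N [k [Pu xE lN Nk _]]]]] := jordan_decomposition x.
have := xorth _ (jordan_additive_normalizes Pu xE lN Nk (rmorphB Num.conj) xL).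
rewrite -(mxtrace_conj_by _ Pu) -conj_byM // conj_byVK // [conj_by P x]xE mulmxDl linearD /=.
have lN' := diag_comm_map Num.conj lN.
rewrite [\tr (N *m _)](@mxtrace_nilp _ _ k) ?addr0; last first.
  have -> := @exprMn_comm _ N (diag_mx (map_mx Num.conj l)) k (esym lN').
  by rewrite Nk mul0r.
have -> : \tr (diag_mx l *m diag_mx (map_mx Num.conj l)) = \sum_i l 0 i * (l 0 i)^*.
  by apply: eq_bigr => i _; rewrite mul_diag_mx !mxE eqxx mulr1n.
move/sum_normC_eq0 => l0; exists k.
have NE : conj_by P x = N by rewrite [conj_by _ _]xE l0 linear0 add0r.
rewrite -(conj_byK x Pu) NE.
by rewrite conj_byX ?unitmx_inv // Nk /conj_by mulmx0 mul0mx.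
Qed.

(** An ideal of nilpotent matrices in an irreducible Lie algebra: the vectors
    it annihilates form a nonzero invariant subspace. *)
Lemma nil_ideal_eq0 (d : nat) (L J : {vspace 'M[K]_d}) :
  (0 < d)%N -> irreducible_mxs L -> (J <= L)%VS ->
  (forall x y, x \in L -> y \in J -> bracket x y \in J) ->
  (forall x, x \in J -> exists m, x ^+ m = 0) -> J = 0%VS.
Proof.
move=> d0 irr JL Jid Jnil; have JL' := subvP JL.
have [W WP] : exists W : {vspace 'cV[K]_d}, 
    forall w, w \in W <-> forall x, x \in J -> x *m w = 0.
  apply: vspace_of_pred => [x _|a u w Ju Jw x Jx]; first by rewrite mulmx0.
  by rewrite mulmxDr -scalemxAr Ju // Jw // scaler0 addr0.
have [w [_ w0 Jw]] : exists w : 'cV[K]_d,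
    [/\ w \in fullv, w \notin 0%VS & forall x, x \in J -> x *m w \in 0%VS].
  apply: (@engel_relative K d J 'cV[K]_d (fun x v => x *m v) 0%VS fullv) => //.
  - by move=> x y /JL' Lx; apply: Jid.
  - by move=> a x y v; rewrite mulmxDl scalemxAl.
  - by move=> x y v _ _; rewrite /bracket mulmxBl !mulmxA.
  - move=> x v /Jnil[m xm]; exists m.
    suff -> : iter m (fun v => x *m v) v = x ^+ m *m v by rewrite xm mul0mx.
    by elim: {xm}m => [|m IH]; rewrite ?mul1mx // iterS IH exprS mulmxA.
  - by move=> x v _; rewrite !memv0 => /eqP ->; rewrite mulmx0.
  - by move=> x v _ _; rewrite memvf.
  - by rewrite subv0 -dimv_eq0 dimvf /dim /= muln1 -lt0n.
have [x v Lx /WP Jv|W0|Wf] := irr W.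
- apply/WP => y Jy; have : bracket x y *m v = 0 by apply/Jv/Jid.
  rewrite /bracket mulmxBl -!mulmxA (Jv y Jy) mulmx0 sub0r => /eqP.
  by rewrite oppr_eq0 => /eqP.
- case/negP: w0; rewrite -W0; apply/WP => x Jx.
  by have := Jw x Jx; rewrite memv0 => /eqP.
- apply/eqP; rewrite -subv0; apply/subvP => x Jx; rewrite memv0; apply/eqP/matrixP => i j.
  have /WP/(_ x Jx) : (delta_mx j 0 : 'cV[K]_d) \in W by rewrite Wf memvf.
  by rewrite -colE => /matrixP/(_ i 0); rewrite !mxE.
Qed.

(** The ideal J of elements orthogonal to the normalizer of L is zero, and it
    contains the brackets of x with L when x is orthogonal to L.  So x is a
    scalar by Schur's lemma, and tr(x^2) = 0. *)
Lemma trace_form_nondegenerate (d : nat) (L : {vspace 'M[K]_d}) x :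
  (0 < d)%N -> irreducible_mxs L -> bracket_closed L ->
  x \in L -> (forall y, y \in L -> \tr (x *m y) = 0) -> x = 0.
Proof.
move=> d0 irr Lb Lx xorth.
pose norm u := forall y, y \in L -> bracket u y \in L.
have [J JP] : exists J : {vspace 'M[K]_d}, forall y,
    y \in J <-> y \in L /\ forall u, norm u -> \tr (y *m u) = 0.
  apply: vspace_of_pred => [|a y z [Ly yo] [Lz zo]].
    by split; rewrite ?mem0v // => u _; rewrite mul0mx linear0.
  split; first by rewrite memvD ?memvZ.
  by move=> u nu; rewrite mulmxDl -scalemxAl linearD linearZ /= yo ?zo // mulr0 addr0.
have J0 : J = 0%VS.
  apply: (nil_ideal_eq0 d0 irr) => [|y z Ly /JP[Lz zo]|y /JP[Ly yo]].
  - by apply/subvP => y /JP[].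
  - apply/JP; split=> [|u nu]; first exact: Lb.
    rewrite bracketC mulNmx linearN /= mxtrace_bracket zo ?oppr0 // => w Lw.
    by apply: Lb => //; rewrite bracketC memvN nu.
  - by apply: (nilp_of_orth_normalizer (L := L)) => // w Lw; apply: Lb.
have xc y : y \in L -> y *m x = x *m y.
  move=> Ly; apply: bracket_eq0; apply/eqP; rewrite -memv0 -J0; apply/JP.
  split=> [|u nu]; first exact: Lb.
  rewrite bracketC mulNmx linearN /= mxtrace_bracket.
  by rewrite xorth ?oppr0 // bracketC memvN nu.
have [c xE] := schur d0 irr xc.
have := xorth x Lx; rewrite xE -scalar_mxM mxtrace_scalar => /eqP.
rewrite mulrn_eq0 -leqn0 leqNgt d0 /= mulf_eq0 orbb => /eqP ->.
by rewrite -scalemx1 scale0r.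
Qed.
End Nondegenerate.

(** A linear form y |-> tr(uy) on L is represented by an element of L. *)
Lemma trace_form_riesz (K : fieldType) (d : nat) (L : {vspace 'M[K]_d}) (u : 'M[K]_d) :
  (forall x, x \in L -> (forall y, y \in L -> \tr (x *m y) = 0) -> x = 0) ->
  exists2 s, s \in L & forall y, y \in L -> \tr (s *m y) = \tr (u *m y).
Proof.
move=> nd; pose b := vbasis L.
have bL i : b`_i \in L.
  have [ib|bi] := ltnP i (size b); last by rewrite nth_default ?mem0v.
  by apply: vbasis_mem; apply: mem_nth.
pose G := \matrix_(i < \dim L, j < \dim L) \tr (b`_i *m b`_j).
have extend s v : (forall j : 'I_(\dim L), \tr (s *m b`_j) = \tr (v *m b`_j)) ->
    forall y, y \in L -> \tr (s *m y) = \tr (v *m y).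
  move=> sv y Ly; rewrite (coord_vbasis Ly) !mulmx_sumr !linear_sum /=.
  by apply: eq_bigr => i _; rewrite -!scalemxAr !linearZ /= sv.
have trG (v : 'rV_(\dim L)) (j : 'I_(\dim L)) :
    \tr ((\sum_i v 0 i *: b`_i) *m b`_j) = (v *m G) 0 j.
  rewrite mulmx_suml linear_sum mxE; apply: eq_bigr => i _.
  by rewrite -scalemxAl linearZ /= [G _ _]mxE.
have Gu : G \in unitmx.
  rewrite -row_free_unit -kermx_eq0.
  apply/rowV0P => v /sub_kermxP vG.
  have s0 : \sum_i v 0 i *: b`_i = 0.
    apply: nd; first by rewrite rpred_sum // => i _; rewrite memvZ.
    move=> y Ly; rewrite (extend _ 0) ?mul0mx ?linear0 // => j.
    by rewrite trG vG mul0mx linear0 mxE.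
  apply/rowP => i; rewrite mxE.
  by have /freeP := basis_free (vbasisP L); apply.
pose v := (\row_(j < \dim L) \tr (u *m b`_j)) *m invmx G.
exists (\sum_i v 0 i *: b`_i); first by rewrite rpred_sum // => i _; rewrite memvZ.
by apply: extend => j; rewrite trG mulmxKV // mxE.
Qed.

(** * Centralizer of a regular diagonalizable element *)

Section TraceReductive.
Variable K : numClosedFieldType.

(** The properties of an irreducible Lie algebra containing the scalar matrices
    that the argument uses: nondegenerate trace form, diagonalizable parts of
    elements belong to L, and only scalars commute with L.  They do not refer to
    a basis, see [trace_reductive_conj]. *)
Record trace_reductive (d : nat) (L : {vspace 'M[K]_d}) : Prop := {
  red_bracket : bracket_closed L;
  red_nondeg : forall x, x \in L -> (forall y, y \in L -> \tr (x *m y) = 0) -> x = 0;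
  red_semisimple : forall (P : 'M[K]_d) (l : 'rV[K]_d) (N : 'M[K]_d) k, P \in unitmx ->
    diag_mx l *m N = N *m diag_mx l -> N ^+ k = 0 ->
    conj_by (invmx P) (diag_mx l + N) \in L -> conj_by (invmx P) (diag_mx l) \in L;
  red_schur : forall F, (forall x, x \in L -> x *m F = F *m x) -> exists c, F = c%:M }.

(** The diagonalizable part s of x normalizes L.  Subtracting from s the element
    of L that represents y |-> tr(sy) leaves a matrix commuting with L, which is
    a scalar, hence in L. *)
Lemma irreducible_trace_reductive (d : nat) (L : {vspace 'M[K]_d}) :
  (0 < d)%N -> irreducible_mxs L -> bracket_closed L -> 1%:M \in L ->
  trace_reductive L.
Proof.
move=> d0 irr Lb L1.
have nd x Lx := @trace_form_nondegenerate K d L x d0 irr Lb Lx.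
split=> // [P l N k Pu lN Nk Lx|F]; last exact: schur.
set x := conj_by _ _ in Lx; set s := conj_by _ _.
have xE : conj_by P x = diag_mx l + N by rewrite conj_byVK.
have sL y : y \in L -> bracket s y \in L.
  have xL z : z \in L -> bracket x z \in L by exact: Lb.
  have := jordan_additive_normalizes (phi := id) Pu xE lN Nk (fun a b => erefl) xL.
  by rewrite map_mx_id //; apply.
have [s' Ls' s'P] := trace_form_riesz s nd.
have sc y : y \in L -> y *m (s - s') = (s - s') *m y.
  move=> Ly; apply/esym/bracket_eq0/nd; first by rewrite bracketDl bracketNl memvB ?sL ?Lb.
  move=> z Lz; rewrite mxtrace_bracket mulmxBl linearB /= s'P ?subrr //.
  exact: Lb.
have [c cE] := schur d0 irr sc.
by rewrite -(subrK s' s) cE memvD // -scalemx1 memvZ.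
Qed.

Lemma trace_reductive_conj (d : nat) (L L' : {vspace 'M[K]_d}) Q :
  Q \in unitmx -> (forall y, y \in L' <-> conj_by (invmx Q) y \in L) ->
  trace_reductive L -> trace_reductive L'.
Proof.
move=> Qu L'P [Lb nd ss sch]; have Vu : invmx Q \in unitmx by rewrite unitmx_inv.
have inL' y : y \in L -> conj_by Q y \in L' by move=> Ly; apply/L'P; rewrite conj_byK.
split.
- by move=> x y /L'P Lx /L'P Ly; apply/L'P; rewrite -bracket_conj_by // Lb.
- move=> x /L'P Lx xo; rewrite -(conj_byVK x Qu) (nd _ Lx) ?/conj_by ?mulmx0 ?mul0mx //.
  move=> y Ly; rewrite -(mxtrace_conj_by _ Qu) -conj_byM // conj_byVK // xo //.
  exact: inL'.
- move=> P l N k Pu lN Nk /L'P Lx; apply/L'P; rewrite conj_by_invM //.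
  by apply: (ss _ _ N k) => //; rewrite ?unitmx_mul ?Pu // -conj_by_invM.
- move=> F FL'; have [y Ly|c cE] := sch (conj_by (invmx Q) F).
    rewrite -{1 2}(conj_byK y Qu) !conj_byM // FL' //; exact: inL'.
  exists c; rewrite -(conj_byVK F Qu) cE /conj_by scalar_mxC -mulmxA mulmxV //.
  by rewrite mulmx1.
Qed.

(** Here D = diag l is an element of L whose eigenvalues have as many distinct
    differences as possible among the diagonalizable elements of L. *)
Section Maximal.
Variables (d : nat) (L : {vspace 'M[K]_d}) (l : 'rV[K]_d).
Hypothesis HL : trace_reductive L.
Local Notation D := (diag_mx l).
Hypothesis LD : D \in L.
Hypothesis maxD : forall P m, P \in unitmx -> conj_by (invmx P) (diag_mx m) \in L ->
  (size (diffs m) <= size (diffs l))%N.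

(** The differences of the entries of m are functions of the corresponding
    differences of the entries of l; in particular m_i = m_j when l_i = l_j. *)
Definition adapted (m : 'rV[K]_d) := forall i j p q : 'I_d,
  l 0 i - l 0 j = l 0 p - l 0 q -> m 0 i - m 0 j = m 0 p - m 0 q.

Lemma adapted_eq m i j : adapted m -> l 0 i = l 0 j -> m 0 i = m 0 j.
Proof.
move=> am lij; apply/eqP; rewrite -subr_eq0 (am i j i i) ?subrr //.
by rewrite lij subrr.
Qed.

Lemma comm_diagP (y : 'M[K]_d) : D *m y = y *m D <-> forall i j, y i j != 0 -> l 0 i = l 0 j.
Proof.
split=> [Dy i j yij|H].
  have /matrixP/(_ i j) := Dy; rewrite mul_diag_mx mul_mx_diag !mxE mulrC.
  by move/(mulfI yij).
apply/matrixP => i j; rewrite mul_diag_mx mul_mx_diag !mxE mulrC.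
by have [->|/H ->//] := eqVneq (y i j) 0; rewrite !mul0r.
Qed.

Lemma adapted_comm m (y : 'M[K]_d) : adapted m -> D *m y = y *m D ->
  diag_mx m *m y = y *m diag_mx m.
Proof.
move=> am /comm_diagP Dy; apply/matrixP => i j.
rewrite mul_diag_mx mul_mx_diag !mxE mulrC.
have [->|/Dy lij] := eqVneq (y i j) 0; first by rewrite !mul0r.
by rewrite (adapted_eq am lij).
Qed.

(** If every coincidence of differences for g is one for f, and some
    coincidence for f is not one for g, then g has more distinct differences. *)
Lemma size_diffs_merge (f g : 'rV[K]_d) i j p q :
  (forall i j p q, g 0 i - g 0 j = g 0 p - g 0 q -> f 0 i - f 0 j = f 0 p - f 0 q) ->
  f 0 i - f 0 j = f 0 p - f 0 q -> g 0 i - g 0 j != g 0 p - g 0 q ->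
  (size (diffs f) < size (diffs g))%N.
Proof.
move=> gf fE gN.
have [phi phiP] : exists phi : K -> K, forall i j, phi (g 0 i - g 0 j) = f 0 i - f 0 j.
  exists (fun v => if [pick r : 'I_d * 'I_d | g 0 r.1 - g 0 r.2 == v] is Some r
                   then f 0 r.1 - f 0 r.2 else 0).
  move=> a b; case: pickP => [r /eqP/gf //|/(_ (a, b))]; by rewrite eqxx.
have sub : {subset diffs f <= undup (map phi (diffs g))}.
  move=> v; rewrite mem_undup => /mapP[r _ ->]; rewrite mem_undup -phiP.
  by apply: map_f; apply: mem_diffs.
apply: leq_ltn_trans (uniq_leq_size (undup_uniq _) sub) _.
rewrite -[X in (_ < X)%N](size_map phi) ltn_size_undup; apply: contra gN => u.
have ix (r s : 'I_d) : (index (g ord0 r - g ord0 s)%R (diffs g) < size (diffs g))%N.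
  by rewrite index_mem mem_diffs.
have := nth_uniq (phi 0) _ _ u => /(_ (index (g 0 i - g 0 j) (diffs g))
  (index (g 0 p - g 0 q) (diffs g))).
rewrite !size_map !ix !(nth_map 0) ?ix // !nth_index ?mem_diffs // !phiP fE eqxx.
move=> /(_ isT isT)/esym/eqP e.
by rewrite -(nth_index 0 (mem_diffs g i j)) e nth_index ?mem_diffs.
Qed.


Lemma exists_notin (s : seq K) : exists t, t \notin s.
Proof.
apply: contrapT => /forallNP H.
have sub : {subset [seq k%:R : K | k <- iota 0 (size s).+1] <= s}.
  by move=> t _; have /negP := H t; rewrite negbK.
have u : uniq [seq k%:R : K | k <- iota 0 (size s).+1].
  by rewrite map_inj_uniq ?iota_uniq //; apply: mulrIn; apply: oner_neq0.
by have := uniq_leq_size u sub; rewrite size_map size_iota ltnn.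
Qed.

(** D and s are diagonalized simultaneously.  If the eigenvalues of s were not
    adapted to those of D, then D + t s would have more distinct eigenvalue
    differences than D for a suitable t. *)
Lemma semisimple_adapted P m (s := conj_by (invmx P) (diag_mx m)) :
  P \in unitmx -> s \in L -> D *m s = s *m D ->
  exists2 m', adapted m' & s = diag_mx m'.
Proof.
move=> Pu Ls Ds.
have [R Ru] : codiagonalizable [:: D; s].
  apply/codiagonalizableP; split; last first.
    move=> A; rewrite !inE => /orP[]/eqP ->; first exact: diagonalizable_diag.
    exists P => //; apply/(similar_diagLR Pu); exists m.
    by rewrite conjumx ?unitmx_inv.
  by apply/all_comm_mxP/all_comm_mx2P.
rewrite /= andbT => /andP[/(similar_diagLR Ru)[l1 DE] /(similar_diagLR Ru)[m1 sE]].
rewrite conjVmx // in DE; rewrite conjVmx // in sE.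
have RD : R *m D = diag_mx l1 *m R by rewrite DE !mulmxA mulmxV // mul1mx.
have Rs : R *m s = diag_mx m1 *m R by rewrite sE !mulmxA mulmxV // mul1mx.
have RE i j : R i j != 0 -> l1 0 i = l 0 j.
  move=> Rij; have /matrixP/(_ i j) := RD; rewrite mul_diag_mx mul_mx_diag !mxE mulrC.
  by move/(mulIf Rij).
have col j : exists i, R i j != 0.
  apply: contrapT => /forallNP R0; have : row j (invmx R *m R) 0 j = 0.
    rewrite !mxE; apply: big1 => i _; have /negP := R0 i.
    by rewrite negbK => /eqP ->; rewrite mulr0.
  by rewrite mulVmx // !mxE eqxx => /eqP; rewrite oner_eq0.
have ad1 i j p q : l1 0 i - l1 0 j = l1 0 p - l1 0 q -> m1 0 i - m1 0 j = m1 0 p - m1 0 q.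
  move=> lE; apply/eqP; apply: contraT => mN.
  pose dl (r : 'I_d * 'I_d * ('I_d * 'I_d)) (v : 'rV[K]_d) :=
    (v 0 r.1.1 - v 0 r.1.2) - (v 0 r.2.1 - v 0 r.2.2).
  have [t] := exists_notin (0 :: [seq - dl r l1 / dl r m1 | r <- enum {: _}]).
  rewrite inE negb_or => /andP[t0 tN].
  have Lt : conj_by (invmx R) (diag_mx (l1 + t *: m1)) \in L.
    rewrite /conj_by invmxK linearD linearZ /= mulmxDr mulmxDl -scalemxAr -scalemxAl.
    by rewrite -DE -sE memvD ?memvZ.
  (* The eigenvalues l1 of D in the new basis are those of l up to order. *)
  have sub : {subset diffs l <= diffs l1}.
    move=> v; rewrite mem_undup => /mapP[[a b] _ -> /=].
    have [a' /RE <-] := col a; have [b' /RE <-] := col b; exact: mem_diffs.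
  have := leq_trans (maxD Ru Lt) (uniq_leq_size (undup_uniq _) sub).
  rewrite leqNgt (@size_diffs_merge _ _ i j p q) // => [a b a' b'|].
    rewrite !mxE => gE; apply/eqP; apply: contraNT tN => lN.
    pose r := ((a, b), (a', b')).
    have gE' : dl r l1 + t * dl r m1 = 0.
      move/eqP: gE; rewrite -subr_eq0 => /eqP <-; rewrite /dl /=; ring.
    have m0 : dl r m1 != 0.
      apply: contraNneq lN => m0; move: gE'; rewrite m0 mulr0 addr0 => /eqP.
      by rewrite /dl subr_eq0.
    apply/mapP; exists r; rewrite ?mem_enum //.
    have -> : dl r l1 = - (t * dl r m1) by apply/eqP; rewrite -addr_eq0 gE'.
    by rewrite opprK mulfK.
  rewrite !mxE; apply: contra mN => /eqP gE; rewrite -subr_eq0 -(mulrI_eq0 _ (mulfI t0)).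
  have -> : t * (m1 0 i - m1 0 j - (m1 0 p - m1 0 q)) =
    (l1 0 i + t * m1 0 i - (l1 0 j + t * m1 0 j))
    - (l1 0 p + t * m1 0 p - (l1 0 q + t * m1 0 q))
     - ((l1 0 i - l1 0 j) - (l1 0 p - l1 0 q)) by ring.
  by rewrite gE lE !subrr.
(* The diagonalizable matrix s is psi(D), so it is diagonal in the given basis. *)
pose psi v := if [pick i | l1 0 i == v] is Some i then m1 0 i else 0.
have psiE i : psi (l1 0 i) = m1 0 i.
  rewrite /psi; case: pickP => [j /eqP lij|/(_ i)]; last by rewrite eqxx.
  by apply/eqP; rewrite -subr_eq0 (ad1 j i i i) ?subrr // lij subrr.
exists (map_mx psi l) => [i j p q|].
  have [[i' /RE Ei] [j' /RE Ej]] := (col i, col j).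
  have [[p' /RE Ep] [q' /RE Eq]] := (col p, col q).
  by rewrite !mxE -Ei -Ej -Ep -Eq !psiE; apply: ad1.
rewrite -(mulKmx Ru s) Rs -[RHS](mulKmx Ru); congr (_ *m _).
apply/matrixP => i j; rewrite mul_diag_mx mul_mx_diag !mxE mulrC.
by have [->|/RE <-] := eqVneq (R i j) 0; rewrite ?mul0r // psiE.
Qed.

Lemma mxtrace_nilp_comm (N M : 'M[K]_d) k : N ^+ k = 0 -> N *m M = M *m N ->
  \tr (N *m M) = 0.
Proof.
move=> Nk NM; apply: (@mxtrace_nilp _ _ _ k).
by have := @exprMn_comm _ N M k NM; rewrite Nk mul0r.
Qed.

Lemma centralizer_jordan h : h \in L -> D *m h = h *m D ->
  exists m n k, [/\ adapted m, h = diag_mx m + n, n ^+ k = 0, n \in L &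
     D *m n = n *m D].
Proof.
move=> Lh Dh; have [P [m [N [k [Pu hE mN Nk hc]]]]] := jordan_decomposition h.
have hE' : conj_by (invmx P) (diag_mx m + N) = h by rewrite -hE conj_byK.
have Ls : conj_by (invmx P) (diag_mx m) \in L.
  by apply: (red_semisimple HL Pu mN Nk); rewrite hE'.
have Ds : D *m conj_by (invmx P) (diag_mx m) = conj_by (invmx P) (diag_mx m) *m D.
  by have := hc D (esym Dh); rewrite /conj_by invmxK => ->.
have [m' am' sE] := semisimple_adapted Pu Ls Ds.
exists m', (h - diag_mx m'), k; split=> //.
- by rewrite addrC subrK.
- have -> : h - diag_mx m' = conj_by (invmx P) N.
    rewrite -sE -hE' -{1}[conj_by _ _]/(_ *m _ *m _) mulmxDr mulmxDl.
    by rewrite addrC addKr.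
  by rewrite conj_byX ?unitmx_inv // Nk /conj_by mulmx0 mul0mx.
- by rewrite -sE memvB.
- by rewrite -sE mulmxBl mulmxBr Dh Ds.
Qed.

(** The diagonal part diag m of n + n' is zero: m is constant on each eigenspace
    of D, and the trace of n + n' on such an eigenspace vanishes. *)
Lemma nilp_centralizer_add n n' k k' :
  n \in L -> D *m n = n *m D -> n ^+ k = 0 ->
  n' \in L -> D *m n' = n' *m D -> n' ^+ k' = 0 ->
  exists k'', (n + n') ^+ k'' = 0.
Proof.
move=> Ln Dn nk Ln' Dn' nk'.
have Dh : D *m (n + n') = (n + n') *m D by rewrite mulmxDl mulmxDr Dn Dn'.
have [m [n'' [k'' [am hE nk'' Ln'' Dn'']]]] := centralizer_jordan (memvD Ln Ln') Dh.
exists k''; suff m0 : m = 0 by rewrite hE m0 linear0 add0r.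
apply/rowP => i; rewrite mxE.
(* E is the projection onto the eigenspace of D for the eigenvalue l_i. *)
pose E := diag_mx (map_mx (fun v => (v == l 0 i)%:R : K) l).
have EC y : D *m y = y *m D -> y *m E = E *m y.
  by move=> Dy; rewrite -(diag_comm_map _ Dy).
have : \tr (diag_mx m *m E) = 0.
  have -> : diag_mx m = n + n' - n'' by rewrite hE addrK.
  rewrite !mulmxDl mulNmx !linearD linearN /=.
  rewrite (mxtrace_nilp_comm nk (EC _ Dn)) (mxtrace_nilp_comm nk' (EC _ Dn')).
  by rewrite (mxtrace_nilp_comm nk'' (EC _ Dn'')) subr0 addr0.
have -> : \tr (diag_mx m *m E) = \sum_(j | l 0 j == l 0 i) m 0 i.
  rewrite [RHS]big_mkcond /=; apply: eq_bigr => j _.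
  rewrite mul_diag_mx !mxE eqxx mulr1n; case: eqP => [lij|_].
    by rewrite mulr1 (adapted_eq am lij).
  by rewrite mulr0.
rewrite sumr_const => /eqP; rewrite mulrn_eq0 => /orP[|/eqP //].
by rewrite -leqn0 leqNgt; case/negP; apply/card_gt0P; exists i; apply: eqxx.
Qed.

(** Components of ad D for eigenvalues that are not opposite are orthogonal for
    the trace form. *)
Lemma mxtrace_diff_part a (w y : 'M[K]_d) :
  (forall i j, w i j != 0 -> l 0 i - l 0 j = - a) ->
  \tr (w *m y) = \tr (w *m diff_part l a y).
Proof.
move=> wa; apply: eq_bigr => i _; rewrite !mxE; apply: eq_bigr => j _.
rewrite mxE; have [->|/wa e] := eqVneq (w i j) 0; first by rewrite !mul0r.
by rewrite -opprB e opprK eqxx.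
Qed.

Lemma diff_partL a y : y \in L -> diff_part l a y \in L.
Proof.
apply: (@diff_part_mem _ _ l 0 1); rewrite ?mulmx0 ?mul0mx ?expr1 // => z Lz.
by rewrite addr0 (red_bracket HL).
Qed.

Lemma diff_part0_comm y : D *m diff_part l 0 y = diff_part l 0 y *m D.
Proof. by apply: bracket_eq0; rewrite bracket_diff_part scale0r. Qed.

(** By polarization of tr(n^2) = 0, n is orthogonal to all nilpotent elements
    of the centralizer of D, hence to the centralizer, hence to L. *)
Lemma nilp_centralizer_eq0 n k : n \in L -> D *m n = n *m D -> n ^+ k = 0 -> n = 0.
Proof.
move=> Ln Dn nk; apply: (red_nondeg HL Ln) => y Ly.
have orth n' k' : n' \in L -> D *m n' = n' *m D -> n' ^+ k' = 0 -> \tr (n *m n') = 0.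
  move=> Ln' Dn' nk'; have [k'' sk] := nilp_centralizer_add Ln Dn nk Ln' Dn' nk'.
  have := mxtrace_nilp_comm sk (erefl _).
  rewrite mulmxDl !mulmxDr !linearD /= (mxtrace_nilp_comm nk) //.
  rewrite (mxtrace_nilp_comm nk' (erefl (n' *m n'))) add0r addr0 mxtrace_mulC -mulr2n => /eqP.
  by rewrite mulrn_eq0 => /eqP.
rewrite (@mxtrace_diff_part 0); last first.
  by move=> i j nij; have /comm_diagP/(_ i j nij) -> := Dn; rewrite subrr oppr0.
have [m [n' [k' [am -> nk' Ln' Dn']]]] :=
  centralizer_jordan (diff_partL 0 Ly) (diff_part0_comm y).
rewrite mulmxDr linearD /= (orth _ _ Ln' Dn' nk') addr0.
by apply: mxtrace_nilp_comm nk _; rewrite adapted_comm.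
Qed.

Lemma centralizer_diag h : h \in L -> D *m h = h *m D ->
  exists2 m, adapted m & h = diag_mx m.
Proof.
move=> Lh Dh; have [m [n [k [am hE nk Ln Dn]]]] := centralizer_jordan Lh Dh.
by exists m; rewrite // hE (nilp_centralizer_eq0 Ln Dn nk) addr0.
Qed.

(** * Root spaces have dimension at most one *)

(** The eigenspace of ad D on L for the eigenvalue a; it is a root space when a
    is nonzero. *)
Definition root_space (a : K) (x : 'M[K]_d) := x \in L /\ bracket D x = a *: x.

Lemma eigen_entry a x i j : bracket D x = a *: x -> x i j != 0 -> l 0 i - l 0 j = a.
Proof.
move=> /matrixP/(_ i j) e xij; move: e; rewrite bracket_diagE mxE.
exact: mulIf.
Qed.

Lemma root_space_diff_part a y : y \in L -> root_space a (diff_part l a y).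
Proof. by move=> Ly; split; [exact: diff_partL | exact: bracket_diff_part]. Qed.

Lemma root_spaceM a b x y : root_space a x -> root_space b y ->
  root_space (a + b) (bracket x y).
Proof.
move=> [Lx xa] [Ly yb]; split; first exact: (red_bracket HL).
by rewrite jacobi xa yb bracketZl bracketZr scalerDl.
Qed.

(** The zero eigenspace is the centralizer of D. *)
Lemma root_space0 h : root_space 0 h -> exists2 m, adapted m & h = diag_mx m.
Proof.
by move=> [Lh]; rewrite scale0r => /bracket_eq0 Dh; apply: centralizer_diag.
Qed.

(** A diagonal matrix with adapted entries acts on the eigenspaces of ad D for a
    and - a by opposite scalars. *)
Lemma adapted_root m a : adapted m -> exists c,
  (forall x, bracket D x = a *: x -> bracket (diag_mx m) x = c *: x) /\
  (forall x, bracket D x = - a *: x -> bracket (diag_mx m) x = - c *: x).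
Proof.
move=> am.
pose c := if [pick r : 'I_d * 'I_d | l 0 r.1 - l 0 r.2 == a] is Some r
          then m 0 r.1 - m 0 r.2 else 0.
have cE i j : l 0 i - l 0 j = a -> m 0 i - m 0 j = c.
  move=> ea; rewrite /c; case: pickP => [r /eqP ra|/(_ (i, j))/=].
    by apply: am; rewrite ea ra.
  by rewrite ea eqxx.
exists c; split=> x xa; apply/matrixP => i j; rewrite bracket_diagE mxE.
  have [->|/(eigen_entry xa)/cE ->//] := eqVneq (x i j) 0; by rewrite !mulr0.
have [->|/(eigen_entry xa) e] := eqVneq (x i j) 0; first by rewrite !mulr0.
by rewrite -(cE j i) ?opprB // -opprB e opprK.
Qed.

(** Put h = [x, y]; then [h, x] = c x and [h, z] = c z with c nonzero, and
    [y, z] = 0.  Hence ad y maps (ad x)^(k + 1) z to a nonzero multiple of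
    (ad x)^k z.  If z were nonzero, so would be all (ad x)^k z, which have the
    eigenvalues (k + 1) c for ad h, while ad h has finitely many eigenvalues. *)
Lemma root_vector_orth a x y z : a != 0 -> root_space a x -> root_space (- a) y ->
  root_space a z -> \tr (x *m y) != 0 -> \tr (z *m y) = 0 -> z = 0.
Proof.
move=> a0 xr yr zr xy zy; set h := bracket x y.
have hr : root_space 0 h by rewrite -(subrr a); apply: root_spaceM.
have [m am hE] := root_space0 hr.
have [c [cp cn]] := adapted_root a am.
have hx : bracket h x = c *: x by rewrite hE cp // xr.2.
have hz : bracket h z = c *: z by rewrite hE cp // zr.2.
have hy : bracket h y = - c *: y by rewrite hE cn // yr.2.
(* If c = 0, then the conjugate of h commutes with y, so the sum of |m_i|^2,
   which is tr(h conj(h)) = tr(x [y, conj(h)]), vanishes. *)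
have c0 : c != 0.
  apply/eqP => c0; rewrite c0 oppr0 scale0r in hy.
  have yb : bracket y (diag_mx (map_mx Num.conj m)) = 0.
    have := diag_comm_map Num.conj (bracket_eq0
      (etrans (esym (congr1 (fun h => bracket h y) hE)) hy)).
    by rewrite bracketC /bracket => ->; rewrite subrr oppr0.
  have : \tr (h *m diag_mx (map_mx Num.conj m)) = 0.
    by rewrite mxtrace_bracket yb mulmx0 linear0.
  rewrite hE.
  have -> : \tr (diag_mx m *m diag_mx (map_mx Num.conj m)) =
      \sum_i m 0 i * (m 0 i)^*.
    by apply: eq_bigr => i _; rewrite mul_diag_mx !mxE eqxx mulr1n.
  move/sum_normC_eq0 => m0; have h0 : h = 0 by rewrite hE m0 linear0.
  have := mxtrace_bracket x y D; rewrite -/h h0 mul0mx linear0 bracketC yr.2.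
  rewrite scaleNr opprK -scalemxAr linearZ /= => /esym/eqP.
  by rewrite mulf_eq0 (negPf a0) (negPf xy).
have yz : bracket y z = 0.
  have wr : root_space 0 (bracket y z) by rewrite -(addNr a); apply: root_spaceM.
  have [mw amw wE] := root_space0 wr.
  apply: (red_nondeg HL wr.1) => k Lk.
  rewrite (@mxtrace_diff_part 0); last first.
    by move=> i j; rewrite oppr0; apply: eigen_entry; case: wr.
  have [mk amk ->] := root_space0 (root_space_diff_part 0 Lk).
  have [ck [ckp _]] := adapted_root a amk.
  rewrite mxtrace_bracket bracketC ckp; last by case: zr.
  by rewrite mulmxN -scalemxAr linearN linearZ /= mxtrace_mulC zy mulr0 oppr0.
apply/eqP; apply: contraT => z0.
pose u k := iter k (bracket x) z.
have hu k : bracket h (u k) = (k.+1%:R * c) *: u k.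
  elim: k => [|k IH]; first by rewrite mul1r.
  rewrite /u /= jacobi hx bracketZl -/(u k) IH bracketZr -scalerDl.
  by rewrite -[k.+2%:R]natr1 mulrDl mul1r addrC.
have yu k : bracket y (u k.+1) = - (c * (k.+1 * k.+2)%:R / 2%:R) *: u k.
  elim: k => [|k IH].
    rewrite /u /= jacobi yz bracketr0 addr0 (bracketC y x) -/h bracketNl hz -scaleNr.
    by congr (_ *: _); field.
  rewrite [u k.+2]/(bracket x (u k.+1)) jacobi IH bracketZr -/(u k.+1).
  rewrite [bracket y x]bracketC -/h.
  rewrite bracketNl hu -scaleNr -[bracket x (u k)]/(u k.+1) -scalerDl; congr (_ *: _).
  by field.
have u0 k : u k != 0.
  elim: k => //= k; apply: contraNneq => uk; have := yu k.
  rewrite [u k.+1]uk bracketr0 => /esym/eqP; rewrite scaler_eq0 oppr_eq0 !mulf_eq0 (negPf c0).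
  by rewrite pnatr_eq0 invr_eq0 pnatr_eq0.
have sub : {subset [seq k.+1%:R * c | k <- iota 0 (size (diffs m)).+1] <= diffs m}.
  move=> _ /mapP[k _ ->]; have /matrix0Pn[i [j uij]] := u0 k.
  have /matrixP/(_ i j) := hu k; rewrite hE bracket_diagE mxE => /(mulIf uij) <-.
  exact: mem_diffs.
have un : uniq [seq k.+1%:R * c | k <- iota 0 (size (diffs m)).+1].
  rewrite map_inj_uniq ?iota_uniq // => i j /(mulIf c0)/eqP.
  by rewrite eqr_nat eqSS => /eqP.
by have := uniq_leq_size un sub; rewrite size_map size_iota ltnn.
Qed.

Lemma root_space_line a : a != 0 ->
  exists2 x, root_space a x & forall z, root_space a z -> exists c, z = c *: x.
Proof.
move=> a0; have [[x [xr x0]]|nx] := pselect (exists x, root_space a x /\ x != 0); last first.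
  exists 0; first by split; rewrite ?mem0v // bracketr0 scaler0.
  move=> z zr; exists 0; rewrite scaler0; apply/eqP; apply: contraT => z0.
  by case: nx; exists z.
exists x => // z zr.
have [y yr xy] : exists2 y, root_space (- a) y & \tr (x *m y) != 0.
  apply: contrapT => ny; case/negP: x0; apply/eqP/(red_nondeg HL xr.1) => y Ly.
  rewrite (@mxtrace_diff_part (- a)); last first.
    by move=> i j; rewrite opprK; apply: eigen_entry; case: xr.
  apply/eqP; apply: contraT => xy; case: ny; exists (diff_part l (- a) y) => //.
  exact: root_space_diff_part.
exists (\tr (z *m y) / \tr (x *m y)); apply/eqP; rewrite -subr_eq0; apply/eqP.
apply: (root_vector_orth a0 xr yr _ xy).
  case: xr zr => [Lx xa] [Lz za]; split; first by rewrite memvB ?memvZ.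
  by rewrite linearB linearZ /= xa za scalerBr !scalerA mulrC.
by rewrite mulmxBl -scalemxAl linearB linearZ /= divfK // subrr.
Qed.

(** * Two elements with scalar commutant *)

(** The brackets of F with the chosen generators X a lie in eigenspaces of ad D
    for distinct eigenvalues and add up to [F, B] = 0, so each of them is zero. *)
Lemma two_element_commutant : exists A B, [/\ A \in L, B \in L &
  forall F, A *m F = F *m A -> B *m F = F *m B -> exists c, F = c%:M].
Proof.
have /choice[X XP] : forall a, exists x, a != 0 -> root_space a x /\
    forall z, root_space a z -> exists c, z = c *: x.
  move=> a; have [->|a0] := eqVneq a 0; first by exists 0.
  by have [x xr xP] := root_space_line a0; exists x.
exists D, (\sum_(a <- diffs l | a != 0) X a); split=> //.
  by rewrite rpred_sum // => a /XP[[]].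
move=> F DF BF; apply: (red_schur HL).
have FX a : a != 0 -> bracket F (X a) = 0.
  move=> a0; have FXe b : b != 0 -> bracket D (bracket F (X b)) = b *: bracket F (X b).
    move=> /XP[[_ e] _]; rewrite jacobi e bracketZr.
    have -> : bracket D F = 0 by rewrite /bracket DF subrr.
    by rewrite bracket0r add0r.
  apply/matrixP => i j; rewrite [RHS]mxE; apply/eqP; apply: contraT => nz.
  have e := eigen_entry (FXe a a0) nz.
  have : bracket F (\sum_(a <- diffs l | a != 0) X a) i j = 0.
    by rewrite /bracket BF subrr mxE.
  (* Only the term of index l_i - l_j contributes to the entry (i, j). *)
  rewrite linear_sum summxE big_mkcond (bigD1_seq a) ?undup_uniq //=; last first.
    by rewrite -e mem_diffs.
  rewrite a0 big1 ?addr0 => [/eqP|b ba]; first by rewrite (negPf nz).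
  case: ifP => // b0; apply/eqP; apply: contraNT ba => nz'.
  by rewrite -(eigen_entry (FXe b b0) nz') e.
move=> y Ly; apply: bracket_eq0.
have <- : \sum_(a <- diffs l) diff_part l a y = y.
  have := sum_diff_part l (fun=> 1) y; under eq_bigr do rewrite scale1r; move=> ->.
  by apply/matrixP => i j; rewrite mxE mul1r.
rewrite bracketC linear_sum big1 ?oppr0 // => a _.
have [->|a0] := eqVneq a 0.
  have [m am ->] := root_space0 (root_space_diff_part 0 Ly).
  by rewrite /= /bracket (adapted_comm am DF) subrr.
have [_ /(_ _ (root_space_diff_part a Ly))[c ->]] := XP a a0.
by rewrite linearZ /= FX ?scaler0.
Qed.
End Maximal.

Lemma trace_reductive_two_element_commutant (d : nat) (L : {vspace 'M[K]_d}) :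
  trace_reductive L -> exists A B, [/\ A \in L, B \in L &
  forall F, A *m F = F *m A -> B *m F = F *m B -> exists c, F = c%:M].
Proof.
move=> HL.
pose S k := `[< exists P l, [/\ P \in unitmx, conj_by (invmx P) (diag_mx l) \in L &
  size (diffs l) = k] >].
have S0 : exists k, S k.
  exists (size (diffs (0 : 'rV[K]_d))); apply/asboolP; exists 1%:M, 0; split.
  - exact: unitmx1.
  - by rewrite linear0 /conj_by mulmx0 mul0mx mem0v.
  - by [].
have Sle k : S k -> (k <= #|{: 'I_d * 'I_d}|)%N.
  move=> /asboolP[P [l [_ _ <-]]]; rewrite cardE; apply: leq_trans (size_undup _) _.
  by rewrite size_map.
case: (ex_maxnP S0 Sle) => k /asboolP[P [l [Pu Ll lk]]] kmax.
have [L' L'P] := conj_vspace P L.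
have HL' := trace_reductive_conj Pu L'P HL.
have L'D : diag_mx l \in L' by apply/L'P.
have [|A [B [LA LB AB]]] := two_element_commutant HL' L'D.
  move=> Q m Qu /L'P LQ; rewrite lk; apply: kmax; apply/asboolP.
  exists (Q *m P), m; split=> //; first by rewrite unitmx_mul Qu.
  by rewrite -conj_by_invM.
exists (conj_by (invmx P) A), (conj_by (invmx P) B); split; try exact/L'P.
move=> F AF BF; have Vu : invmx P \in unitmx by rewrite unitmx_inv.
have [||c cE] := AB (conj_by P F).
- by rewrite -(conj_byVK A Pu) !conj_byM // AF.
- by rewrite -(conj_byVK B Pu) !conj_byM // BF.
exists c; rewrite -(conj_byK F Pu) cE /conj_by scalar_mxC -mulmxA mulmxV //.
by rewrite mulmx1.
Qed.

(** Adding scalar matrices to L or to A and B changes neither irreducibility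
    nor the commutants. *)
Lemma irreducible_two_element_commutant (d : nat) (L : {vspace 'M[K]_d}) :
  (0 < d)%N -> irreducible_mxs L -> bracket_closed L ->
  exists A B, [/\ A \in L, B \in L &
  forall F, A *m F = F *m A -> B *m F = F *m B -> exists c, F = c%:M].
Proof.
move=> d0 irr Lb; pose L1 := (L + <[1%:M]>)%VS.
have LL1 := subvP (addvSl L <[1%:M : 'M[K]_d]>).
have L1P x : x \in L1 -> exists2 y, y \in L & exists a, x = y + a%:M.
  move=> /memv_addP[y Ly [_ /vlineP[a ->] ->]]; exists y => //; exists a.
  by rewrite scalemx1.
have [|A1 [B1 [/L1P[A LA [a ->]] /L1P[B LB [b ->]] AB]]] :=
    @trace_reductive_two_element_commutant d L1.
- apply: irreducible_trace_reductive => // [W WL1|x y /L1P[x' Lx [a ->]] /L1P[y' Ly [b ->]]|].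
  + by apply: irr => x v /LL1; apply: WL1.
  + by rewrite bracketDl !bracketDr !bracket_scalarr !bracket_scalarl !addr0 LL1 ?Lb.
  + exact: (subvP (addvSr L <[1%:M]>)) (memv_line _).
exists A, B; split=> // F AF BF; apply: AB.
  by rewrite mulmxDl mulmxDr AF scalar_mxC.
by rewrite mulmxDl mulmxDr BF scalar_mxC.
Qed.
End TraceReductive.

(** * Polynomial maps along lines *)

Section PolynomialLines.
Variable K : closedFieldType.

Lemma poly_eq0_of_horner (p : {poly K}) : (forall t, p.[t] = 0) -> p = 0.
Proof.
move=> p0; apply/eqP; apply: contraT => /closed_nonrootP[t].
by rewrite /root p0 eqxx.
Qed.

(** A polynomial matrix Q commuting with A0 + t A1 and B0 + t B1.  Comparing
    coefficients, [A0, Q_k] = - [A1, Q_(k-1)] with Q_(-1) = 0, and likewise for B, so by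
    induction on k each coefficient Q_k commutes with A0 and B0. *)
Lemma scalar_along_line (d : nat) (Q : 'M[{poly K}]_d) (A0 A1 B0 B1 : 'M[K]_d) :
  (forall t, (A0 + t *: A1) *m map_mx (horner_eval t) Q
     = map_mx (horner_eval t) Q *m (A0 + t *: A1)) ->
  (forall t, (B0 + t *: B1) *m map_mx (horner_eval t) Q
     = map_mx (horner_eval t) Q *m (B0 + t *: B1)) ->
  (forall F, A0 *m F = F *m A0 -> B0 *m F = F *m B0 -> exists c, F = c%:M) ->
  exists q : {poly K}, Q = q%:M.
Proof.
move=> AQ BQ sc; pose Qk k : 'M[K]_d := map_mx (fun p : {poly K} => p`_k) Q.
have coef (C0 C1 : 'M[K]_d) : (forall t, (C0 + t *: C1) *m map_mx (horner_eval t) Q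
     = map_mx (horner_eval t) Q *m (C0 + t *: C1)) ->
    forall k, bracket C0 (Qk k) = - if k is k'.+1 then bracket C1 (Qk k') else 0.
  move=> CQ; pose C := map_mx polyC C0 + 'X *: map_mx polyC C1.
  have CE t : map_mx (horner_eval t) C = C0 + t *: C1.
    by apply/matrixP => i j; rewrite !mxE /horner_eval !hornerE.
  have E0 : C *m Q = Q *m C.
    apply/eqP; rewrite -subr_eq0; apply/eqP/matrixP => i j; rewrite [RHS]mxE.
    apply: poly_eq0_of_horner => t.
    have /matrixP/(_ i j) := CQ t; rewrite -CE -!map_mxM !mxE /horner_eval => /eqP.
    by rewrite -subr_eq0 -hornerN -hornerD => /eqP.
  have coefl k : map_mx (fun p : {poly K} => p`_k) (C *m Q) =
      C0 *m Qk k + if k is k'.+1 then C1 *m Qk k' else 0.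
    apply/matrixP => i j; rewrite !mxE coef_sum.
    case: k => [|k]; rewrite mxE ?addr0 -?big_split /=; apply: eq_bigr => r _.
      by rewrite !mxE mulrDl coefD coefCM -mulrA coefXM addr0.
    by rewrite !mxE mulrDl coefD coefCM -mulrA coefXM coefCM.
  have coefr k : map_mx (fun p : {poly K} => p`_k) (Q *m C) =
      Qk k *m C0 + if k is k'.+1 then Qk k' *m C1 else 0.
    apply/matrixP => i j; rewrite !mxE coef_sum.
    case: k => [|k]; rewrite mxE ?addr0 -?big_split /=; apply: eq_bigr => r _.
      by rewrite !mxE mulrC mulrDl coefD coefCM -mulrA coefXM addr0 mulrC.
    by rewrite !mxE mulrC mulrDl coefD coefCM -mulrA coefXM coefCM mulrC [C1 _ _ * _]mulrC.
  move=> k; have := coefl k; rewrite E0 coefr => /esym/eqP.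
  rewrite -subr_eq0 opprD addrACA addr_eq0 => /eqP.
  by case: k => [|k] E; rewrite [bracket C0 _]E ?subrr.
have scal k : exists c, Qk k = c%:M.
  elim: k => [|k [c IH]]; apply: sc; apply: bracket_eq0.
  - by rewrite (coef _ _ AQ) oppr0.
  - by rewrite (coef _ _ BQ) oppr0.
  - by rewrite (coef _ _ AQ) IH bracket_scalarr oppr0.
  - by rewrite (coef _ _ BQ) IH bracket_scalarr oppr0.
case: d Q A0 A1 B0 B1 {AQ BQ sc coef} @Qk scal => [|d] Q _ _ _ _ Qk scal.
  by exists 0; apply/matrixP => -[].
exists (Q 0 0); apply/matrixP => i j; apply/polyP => k; rewrite mxE.
have [c /matrixP cE] := scal k.
have Qc r s : (Q r s)`_k = c *+ (r == s) by have := cE r s; rewrite !mxE.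
by rewrite Qc; case: eqP => _; rewrite ?mulr1n ?Qc ?eqxx // mulr0n coef0.
Qed.

Lemma polynomial_function_line (m n : nat) (f : 'M[K]_(m, n) -> K) X Y :
  polynomial_function f -> exists q : {poly K}, forall t, f (X + t *: Y) = q.[t].
Proof.
case=> p fp; exists (mpoly.mmap polyC (fun k => (mxvec X 0 k)%:P + mxvec Y 0 k *: 'X) p) => t.
rewrite fp mpoly.mevalE /mpoly.mmap horner_sum; apply: eq_bigr => u _.
rewrite hornerCM /mpoly.mmap1 horner_prod; congr (_ * _); apply: eq_bigr => k _.
by rewrite horner_exp !hornerE linearD linearZ !mxE mulrC.
Qed.

Lemma linear_polynomial_function (m n : nat) (g : 'M[K]_(m, n) -> K) :
  scalar g -> polynomial_function g.
Proof.
move=> gl; pose h : {scalar 'M[K]_(m, n)} := HB.pack g (GRing.isLinear.Build _ _ _ _ g gl).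
exists (\sum_(k < m * n) h (vec_mx (delta_mx 0 k)) *:
  (mpoly.mpolyX K (mpoly.mnm1 k) : mpoly.mpoly (m * n) K)) => X.
have -> : g X = h (vec_mx (\sum_k mxvec X 0 k *: delta_mx 0 k)).
  by rewrite -row_sum_delta mxvecK.
rewrite raddf_sum !linear_sum /=; apply: eq_bigr => k _.
by rewrite mpoly.mevalZ mpoly.mevalXU -[LHS]/(h _) !linearZ /= mulrC.
Qed.

Lemma scalar_of_commuting_rows (m n d : nat) (rho : 'rV[K]_n -> 'M[K]_d)
    (F : 'M[K]_(m, n) -> 'M[K]_d) (i j : 'I_m) (a b : 'rV[K]_n) :
  linear rho -> i != j -> (forall r s, polynomial_function (fun X => F X r s)) ->
  (forall X, rho (row i X) *m F X = F X *m rho (row i X)) ->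
  (forall X, rho (row j X) *m F X = F X *m rho (row j X)) ->
  (forall Phi, rho a *m Phi = Phi *m rho a -> rho b *m Phi = Phi *m rho b ->
     exists c, Phi = c%:M) ->
  forall X, exists c, F X = c%:M.
Proof.
move=> rl ij Fp Fi Fj sc X.
pose h : {linear 'rV[K]_n -> 'M[K]_d} := HB.pack rho (GRing.isLinear.Build _ _ _ _ rho rl).
(* A point where the rows i and j are a and b; the line joins it to X. *)
pose X0 : 'M[K]_(m, n) := \matrix_(k < m) if k == i then a else b.
pose Y := X - X0.
have row_i t : rho (row i (X0 + t *: Y)) = rho a + t *: rho (row i Y).
  by rewrite -[rho _]/(h _) linearD linearZ linearD linearZ /= rowK eqxx.
have row_j t : rho (row j (X0 + t *: Y)) = rho b + t *: rho (row j Y).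
  by rewrite -[rho _]/(h _) linearD linearZ linearD linearZ /= rowK eq_sym (negPf ij).
have /choice[q qP] : forall rs : 'I_d * 'I_d, exists q : {poly K},
    forall t, F (X0 + t *: Y) rs.1 rs.2 = q.[t].
  by move=> rs; apply: (polynomial_function_line X0 Y (Fp rs.1 rs.2)).
pose Q : 'M[{poly K}]_d := \matrix_(r, s) q (r, s).
have QE t : map_mx (horner_eval t) Q = F (X0 + t *: Y).
  by apply/matrixP => r s; rewrite [LHS]mxE [Q r s]mxE /horner_eval -(qP (r, s)).
have [p QS] : exists p : {poly K}, Q = p%:M.
  apply: (@scalar_along_line d Q (rho a) (rho (row i Y)) (rho b) (rho (row j Y))) => // t.
    by rewrite QE -row_i.
  by rewrite QE -row_j.
exists p.[1]; have -> : X = X0 + 1 *: Y by rewrite scale1r addrC subrK.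
by rewrite -QE QS map_scalar_mx.
Qed.
End PolynomialLines.

(** * Limits and differentials of matrix-valued maps *)

Section MatrixAnalysis.
Variable K : numFieldType.

Lemma cvg_mx_entries (T : Type) (F : set_system T) (m n : nat)
    (f : T -> 'M[K]_(m, n)) (A : 'M[K]_(m, n)) : Filter F ->
  (forall i j, f x i j @[x --> F] --> A i j) -> f x @[x --> F] --> A.
Proof.
move=> FF fA; apply/cvg_ballP => e e0.
have H : \forall x \near F, forall ij : 'I_m * 'I_n, ball (A ij.1 ij.2) e (f x ij.1 ij.2).
  by apply: filter_forall => ij; have /cvg_ballP := fA ij.1 ij.2; apply.
by apply: filterS H => x H; split=> // i j; apply: (H (i, j)).
Qed.

Lemma cvg_mx_entry (T : Type) (F : set_system T) (m n : nat)
    (f : T -> 'M[K]_(m, n)) (A : 'M[K]_(m, n)) i j : Filter F ->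
  f x @[x --> F] --> A -> f x i j @[x --> F] --> A i j.
Proof.
move=> FF fA; apply: (@continuous_cvg _ _ _ F FF f (fun M : 'M[K]_(m, n) => M i j) A) => //.
exact: coord_continuous.
Qed.

Lemma cvg_mulmx (T : Type) (F : set_system T) (m n p : nat)
    (f : T -> 'M[K]_(m, n)) (g : T -> 'M[K]_(n, p)) (A : 'M[K]_(m, n)) (B : 'M[K]_(n, p)) :
  Filter F ->
  f x @[x --> F] --> A -> g x @[x --> F] --> B -> f x *m g x @[x --> F] --> A *m B.
Proof.
move=> FF fA gB; apply: cvg_mx_entries => i j; rewrite mxE.
under eq_fun do rewrite mxE.
apply: cvg_big => [|k _]; first exact: add_continuous.
by apply: cvgM; apply: cvg_mx_entry.
Qed.

Lemma linear_mx_continuous (m n : nat) (V : normedModType K)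
    (g : {linear 'M[K]_(m, n) -> V}) : continuous g.
Proof.
have -> : g = (fun M => \sum_i \sum_j M i j *: g (delta_mx i j)) :> (_ -> _).
  apply: funext => M; rewrite {1}[M]matrix_sum_delta linear_sum.
  by apply: eq_bigr => i _; rewrite linear_sum; apply: eq_bigr => j _; rewrite linearZ.
apply: continuous_big => [|i _]; first exact: add_continuous.
apply: continuous_big => [|j _]; first exact: add_continuous.
move=> M; apply: (@continuous_cvg _ _ _ (nbhs M) _ (fun N : 'M[K]_(m, n) => N i j)
  (fun x => x *: g (delta_mx i j)) (M i j)); first exact: scalel_continuous.
exact: coord_continuous.
Qed.

Lemma near_eq_differentiable (V W : normedModType K) (f g : V -> W) (a : V) :
  (\near a, f a = g a) -> differentiable f a -> differentiable g a.
Proof.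
move=> fg df; apply/diffP.
apply: (@getPex _ (fun (df : {linear V -> W}) => continuous df /\
  forall y, g y = g (lim (nbhs a)) + df (y - lim (nbhs a))
                  +o_(y \near a) (y - lim (nbhs a)))).
exists ('d f a); split; first exact: diff_continuous.
apply/eqaddoEx => y; move: y; apply/funeqP/eqaddoP => e e0.
have /diffP[_ /funeqP/eqaddoP/(_ e e0)] := df.
rewrite lim_id //; apply: filter_app; near=> y.
rewrite -[(f - _) y]/(f y - (f a + 'd f a (y - a))) -[(g - _) y]/(g y - (g a + 'd f a (y - a))).
by rewrite (nbhs_singleton fg) (near fg y).
Unshelve. all: by end_near. Qed.

(** The differential of the relation f (phi y) = h (f y) at a fixed point of
    phi. *)
Lemma diff_intertwine (U W : normedModType K) (f : U -> W) (phi : U -> U)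
    (h : {linear W -> W}) (x v : U) :
  phi x = x -> differentiable phi x -> differentiable f x -> continuous h ->
  (\forall y \near x, f (phi y) = h (f y)) ->
  'd f x ('d phi x v) = h ('d f x v).
Proof.
move=> phix Dphi Df hc fphi.
have Df' : differentiable f (phi x) by rewrite phix.
have Dh : differentiable h (f x) by exact: linear_differentiable.
have := @near_eq_derive _ _ _ (f \o phi) (h \o f) x v fphi.
rewrite !deriveE; try exact: differentiable_comp.
by rewrite (diff_comp Dphi Df') (diff_comp Df Dh) (diff_lin _ hc) /= phix.
Qed.
End MatrixAnalysis.

(** * The tangent representation *)

Section LieGroup.
Variables (K : numClosedFieldType) (n d : nat) (G : complexLieGroupType K n).
Variables (c : chart G 'rV[K]_n) (Psi : G -> 'M[K]_d).
Hypothesis c1 : chart_at_1 c.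
Hypothesis PsiR : is_representation Psi.

Lemma repr_one : Psi 1%g = 1%:M.
Proof.
have := repr_mul PsiR 1%g 1%g; rewrite mulg1 => e.
by rewrite -(mulKmx (repr_unit PsiR 1%g) (Psi 1%g)) -e mulVmx ?(repr_unit PsiR).
Qed.

Lemma invmx_repr g : invmx (Psi g) = Psi g^-1%g.
Proof.
have e : Psi g *m Psi g^-1%g = 1%:M by rewrite -(repr_mul PsiR) mulgV repr_one.
by rewrite -[RHS](mulKmx (repr_unit PsiR g)) e mulmx1.
Qed.

Lemma chart_inv_at (a : chart G 'rV[K]_n) p : atlas a -> chart_dom a p ->
  chart_inv a (a p) = p.
Proof. by move=> /atlas_chart[_ _ _ _]; apply. Qed.

Lemma chart_inv_cvg (a : chart G 'rV[K]_n) p : atlas a -> chart_dom a p ->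
  chart_inv a x @[x --> a p] --> p.
Proof.
move=> Aa ap; have [_ oi _] := atlas_chart _ Aa.
rewrite (continuous_open_subspace _ oi) => ci _.
have : a p \in chart_im a by rewrite inE; exists p.
by move/ci; rewrite /continuous_at chart_inv_at.
Qed.

Lemma mulg_cvg (T : Type) (F : set_system T) (f g : T -> G) (a b : G) : Filter F ->
  f x @[x --> F] --> a -> g x @[x --> F] --> b -> (f x * g x)%g @[x --> F] --> (a * b)%g.
Proof.
move=> FF fa gb; have [mc _] := @mulg_holomorphic K n G.
apply: (@continuous_cvg _ _ _ F FF (fun x => (f x, g x))
  (fun p : G * G => (p.1 * p.2)%g) (a, b)).
  exact: mc.
exact: cvg_pair.
Qed.

Lemma chart_mul_differentiable (a b e : chart G 'rV[K]_n) (g h : G) :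
  atlas a -> atlas b -> atlas e -> chart_dom a g -> chart_dom b h ->
  chart_dom e (g * h)%g ->
  differentiable (fun p : 'rV[K]_n * 'rV[K]_n => e (chart_inv a p.1 * chart_inv b p.2)%g)
    (a g, b h).
Proof.
move=> Aa Ab Ae ag bh egh; have [_ /(_ (chart_prod a b) e)] := @mulg_holomorphic K n G.
move=> /(_ _ Ae)[|_]; first by exists a, b.
apply; split; first by exists (g, h).
by rewrite /= !chart_inv_at.
Qed.

(** Conjugation by g is a right translation after a left one; a chart b around
    g is used between the two. *)
Lemma Ad_differentiable (g : G) :
  differentiable (fun x => c (g * chart_inv c x * g^-1)%g) (c 1%g).
Proof.
have [Ac d1] := c1.
have [b Ab bg] := atlas_cover g; have [b' Ab' bg'] := atlas_cover g^-1%g.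
have bg1 : chart_dom b (g * 1)%g by rewrite mulg1.
have c1' : chart_dom c (g * g^-1)%g by rewrite mulgV.
have D1 := chart_mul_differentiable Ab Ac Ab bg d1 bg1.
have D2 := chart_mul_differentiable Ab Ab' Ac bg bg' c1'.
have E1 : differentiable (fun x => b (g * chart_inv c x)%g) (c 1%g).
  have := @differentiable_comp _ _ _ _ (fun x : 'rV[K]_n => (b g, x)) _ (c 1%g) _ D1.
  rewrite /comp /= chart_inv_at //; apply.
  by apply: differentiable_pair.
have E2 : differentiable (fun y => c (chart_inv b y * g^-1)%g) (b g).
  have := @differentiable_comp _ _ _ _ (fun x : 'rV[K]_n => (x, b' g^-1%g)) _ (b g) _ D2.
  rewrite /comp /= chart_inv_at //; apply.
  by apply: differentiable_pair.
have bg1E : b (g * chart_inv c (c 1%g))%g = b g by rewrite chart_inv_at // mulg1.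
rewrite -bg1E in E2.
apply: near_eq_differentiable (differentiable_comp E1 E2).
have : (g * chart_inv c x)%g @[x --> c 1%g] --> (g * 1)%g.
  exact: (@mulg_cvg _ (nbhs (c 1%g)) (fun=> g) (chart_inv c) g 1%g _
    (cvg_cst g) (chart_inv_cvg Ac d1)).
rewrite mulg1; have [ob _ _ _ _] := atlas_chart _ Ab.
move=> /(_ _ (open_nbhs_nbhs (conj ob bg))).
apply: (@filterS _ (nbhs (c 1%g)) (nbhs_filter _)) => x /= bx.
by rewrite chart_inv_at.
Qed.

Lemma repr_chart_differentiable : differentiable (fun x => Psi (chart_inv c x)) (c 1%g).
Proof.
have [Ac d1] := c1; have [_ /(_ c (chart_id _) Ac erefl)[_]] := repr_holomorphic PsiR.
by apply; split => //; exists 1%g.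
Qed.

Lemma tangent_repr_linear : linear (tangent_repr c Psi).
Proof. exact: linearP. Qed.

(** The differential at the unit of Psi (g p g^-1) = Psi g Psi p Psi g^-1. *)
Lemma tangent_repr_Ad (g : G) v :
  tangent_repr c Psi (Ad c g v) = Psi g *m tangent_repr c Psi v *m invmx (Psi g).
Proof.
have [Ac d1] := c1.
pose f x := Psi (chart_inv c x).
pose phi x := c (g * chart_inv c x * g^-1)%g.
have phi1 : phi (c 1%g) = c 1%g by rewrite /phi chart_inv_at // mulg1 mulgV.
pose h : {linear 'M[K]_d -> 'M[K]_d} := mulmxr (invmx (Psi g)) \o mulmx (Psi g).
have hc : continuous h by exact: linear_mx_continuous.
have Df : differentiable f (c 1%g) := repr_chart_differentiable.
have Dphi : differentiable phi (c 1%g) := Ad_differentiable g.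
apply: (diff_intertwine (h := h) v phi1 Dphi Df hc).
  have : (g * chart_inv c x * g^-1)%g @[x --> c 1%g] --> (g * 1 * g^-1)%g.
    exact: (@mulg_cvg _ (nbhs (c 1%g)) _ (fun=> g^-1%g) _ _ _
      (@mulg_cvg _ (nbhs (c 1%g)) (fun=> g) (chart_inv c) g 1%g _
         (cvg_cst g) (chart_inv_cvg Ac d1)) (cvg_cst g^-1%g)).
  rewrite mulg1 mulgV; have [oc _ _ _ _] := atlas_chart _ Ac.
  move=> /(_ _ (open_nbhs_nbhs (conj oc d1))).
  apply: (@filterS _ (nbhs (c 1%g)) (nbhs_filter _)) => x /= cx.
  rewrite /f /phi (chart_inv_at Ac cx) (repr_mul PsiR (g * chart_inv c x)%g).
  by rewrite (repr_mul PsiR g) (invmx_repr g).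
Qed.

Lemma tangent_repr_image : exists L : {vspace 'M[K]_d},
  forall y, y \in L <-> exists u, y = tangent_repr c Psi u.
Proof.
apply: vspace_of_pred => [|a _ _ [u1 ->] [u2 ->]].
  by exists 0; rewrite /tangent_repr linear0.
by exists (a *: u1 + u2); rewrite tangent_repr_linear.
Qed.

(** Write f for Psi in the chart.  Every f(x) Y f(x)^-1 lies in the image L of
    the tangent representation, by [tangent_repr_Ad]; so does the limit, as h
    tends to 0 and x = c(1) + h v, of
    [h^-1 (f(x) - 1), Y] f(x)^-1 = h^-1 (f(x) Y f(x)^-1 - Y). *)
Lemma tangent_repr_bracket v w :
  exists u, bracket (tangent_repr c Psi v) (tangent_repr c Psi w) = tangent_repr c Psi u.
Proof.
have [Ac d1] := c1.
pose f x := Psi (chart_inv c x); set Y := tangent_repr c Psi w.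
have [L LP] := tangent_repr_image.
apply/LP.
(* T is a continuous linear map with kernel L. *)
pose T : {linear 'M[K]_d -> 'M[K]_d} := idfun \- projv L.
have TL y : y \in L <-> T y = 0.
  split=> [Ly|/eqP]; first by rewrite /= projv_id // subrr.
  by rewrite /= subr_eq0 => /eqP ->; apply: memv_proj.
have Tc : continuous T by exact: linear_mx_continuous.
pose x_ (h : K) := h *: v + c 1%g.
have f1 : f (c 1%g) = 1%:M by rewrite /f chart_inv_at // repr_one.
pose q h := h^-1 *: (f (x_ h) - f (c 1%g)).
have qc : q h @[h --> 0^'] --> tangent_repr c Psi v.
  rewrite /tangent_repr -deriveE; last exact: repr_chart_differentiable.
  by have := @diff_derivable _ _ _ f (c 1%g) v repr_chart_differentiable.
have xc : x_ h @[h --> 0^'] --> c 1%g.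
  rewrite -[X in _ --> X]add0r -[X in X + _](scale0r v).
  apply: cvgD; last exact: cvg_cst.
  apply: cvgZr_tmp; exact: nbhs_dnbhs.
have gc : chart_inv c (x_ h) @[h --> 0^'] --> 1%g.
  exact: cvg_comp xc (chart_inv_cvg Ac d1).
have fVc : Psi (chart_inv c (x_ h))^-1%g @[h --> 0^'] --> (1%:M : 'M[K]_d).
  have [ic _] := @invg_holomorphic K n G; have [pc _] := repr_holomorphic PsiR.
  rewrite -repr_one -[1%g in X in _ --> X]invg1.
  apply: (@continuous_cvg _ _ _ _ _ _ Psi _ (pc _)).
  exact: (@continuous_cvg _ _ _ _ _ _ (fun g : G => g^-1%g) _ (ic 1%g) gc).
have lim : T (bracket (q h) Y *m Psi (chart_inv c (x_ h))^-1%g) @[h --> 0^']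
    --> T (bracket (tangent_repr c Psi v) Y *m 1%:M).
  apply: (@continuous_cvg _ _ _ _ _ _ T); first exact: Tc.
  apply: cvg_mulmx fVc; apply: cvgB; apply: cvg_mulmx; try exact: cvg_cst; exact: qc.
have T0 h : T (bracket (q h) Y *m Psi (chart_inv c (x_ h))^-1%g) = 0.
  apply/TL; rewrite /q bracketZl -scalemxAl memvZ // f1 bracketDl bracketNl.
  rewrite bracket_scalarl subr0 /bracket mulmxBl -invmx_repr -!mulmxA mulmxV ?(repr_unit PsiR) //.
  rewrite mulmx1 mulmxA memvB //; last by apply/LP; exists w.
  by apply/LP; exists (Ad c (chart_inv c (x_ h)) w); rewrite tangent_repr_Ad.
apply/TL; rewrite -[bracket _ _]mulmx1.
apply: (cvg_unique _ lim); first exact: norm_hausdorff.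
by apply: cvg_near_cst; apply: nearW => h; apply: T0.
Qed.
End LieGroup.

(** * The center of the algebra of concomitants *)

Theorem theorem2p4 (R : realType) (n d : nat) (G : complexLieGroupType R[i] n)
    (c : chart G 'rV[R[i]]_n) (Psi : G -> 'M[R[i]]_d) :
  chart_at_1 c ->
  is_representation Psi ->
  irreducible_rep (tangent_repr c Psi) ->
  forall m : nat, (2 <= m)%N ->
    pointwise_center (concomitants c Psi m) =
    [set (fun X : 'M[R[i]]_(m, n) => f X *: 1%:M) | f in invariant_polynomials c m].
Proof.
move=> c1 PsiR [d0 irr] m m2; set rho := tangent_repr c Psi.
have rhoL : linear rho := tangent_repr_linear c Psi.
pose i0 : 'I_m := Ordinal (ltnW m2); pose i1 : 'I_m := Ordinal m2.
have conj_scalar g (a : R[i]) : Psi g *m a%:M *m invmx (Psi g) = a%:M.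
  by rewrite scalar_mxC -mulmxA mulmxV ?mulmx1 // (repr_unit PsiR).
apply/seteqP; split=> F /=.
- case=> [[Fp Fe] Fc].
  have [L LP] := tangent_repr_image c Psi.
  have [|x y /LP[u ->] /LP[v ->]|A [B [/LP[a ->] /LP[b ->] sc]]] :=
      @irreducible_two_element_commutant _ d L d0.
  + by move=> W WL; apply: irr => X v; apply: WL; apply/LP; exists X.
  + by apply/LP; apply: tangent_repr_bracket.
  have rho_row i : concomitants c Psi m (fun X => rho (row i X)).
    split=> [r s|g X]; last first.
      by rewrite /Ad_sum rowK; apply: tangent_repr_Ad.
    apply: linear_polynomial_function => t X Y.
    by rewrite linearD linearZ rhoL !mxE.
  have Fs := scalar_of_commuting_rows rhoL (isT : i0 != i1) Fp
     (fun X => esym (Fc _ (rho_row i0) X)) (fun X => esym (Fc _ (rho_row i1) X)) sc.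
  have FE X : F X = F X (Ordinal d0) (Ordinal d0) *: 1%:M.
    by have [t ->] := Fs X; rewrite mxE eqxx mulr1n scalemx1.
  exists (fun X => F X (Ordinal d0) (Ordinal d0)); last by apply: funext => X; rewrite -FE.
  split=> [|g X]; first exact: Fp.
  by rewrite Fe; have [t ->] := Fs X; rewrite conj_scalar.
- case=> f [[p fp] fi] <-; split; last first.
    by move=> H _ X; rewrite -scalemxAl -scalemxAr mul1mx mulmx1.
  split=> [i j|g X]; last by rewrite fi scalemx1 conj_scalar.
  exists ((i == j)%:R *: p) => X.
  by rewrite mpoly.mevalZ -fp !mxE mulrC.
Qed.
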